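(* Let $\mathcal{L}$ be the operator $$\mathcal{L}=\frac{1}{V(x)}\sum_{i,j=1}^N\frac{\partial}{\partial x_i}\Big(V(x)\,a_{i,j}(x)\,\frac{\partial}{\partial x_j}\Big),\qquad x\in\mathbb{R}^N,$$ where $V\in C^\infty(\mathbb{R}^N,\mathbb{R})$ is positive, $a_{i,j}\in C^\infty(\mathbb{R}^N,\mathbb{R})$, and the matrix $A(x)=(a_{i,j}(x))_{i,j}$ is symmetric and positive semi-definite for every $x\in\mathbb{R}^N$. Assume that $A(x)\neq 0$ for every $x\in\mathbb{R}^N$ (equivalently, $\mathrm{trace}(A(x))>0$ for every $x\in\mathbb{R}^N$), and that $\mathcal{L}$ is $C^\infty$-hypoelliptic in every open subset of $\mathbb{R}^N$. Let $\Omega\subseteq\mathbb{R}^N$ be a connected open set. Then: (1) Any function $u\in C^2(\Omega,\mathbb{R})$ satisfying $\mathcal{L}u\geq 0$ on $\Omega$ and attaining a maximum in $\Omega$ is constant throughout $\Omega$. (2) If $c\in C^\infty(\mathbb{R}^N,\mathbb{R})$ is nonnegative on $\mathbb{R}^N$ and $\mathcal{L}_c:=\mathcal{L}-c$, then any function $u\in C^2(\Omega,\mathbb{R})$ satisfying $\mathcal{L}_c u\geq 0$ on $\Omega$ and attaining a nonnegative maximum in $\Omega$ is constant throughout $\Omega$.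
   Context: A linear differential operator $L$ with smooth coefficients is $C^\infty$-hypoelliptic in an open set $\Omega\subseteq\mathbb{R}^N$ if, for every distribution $u\in\mathcal{D}'(\Omega)$, every open set $U\subseteq\Omega$ and every $f\in C^\infty(U,\mathbb{R})$, the equation $Lu=f$ in $U$ (in the sense of distributions) implies that $u$ is (a function-type distribution associated with) a $C^\infty$ function on $U$. The operator $\mathcal{L}-c$ acts as $u\mapsto \mathcal{L}u-c\,u$. *)

(* Defs.v *)
From HB Require Import structures.
From mathcomp Require Import all_boot all_order all_algebra.
From mathcomp Require Import all_classical all_reals all_analysis.
Import Order.TTheory GRing.Theory Num.Theory.
Import numFieldNormedType.Exports.

Set Implicit Arguments.
Unset Strict Implicit.
Unset Printing Implicit Defensive.

Local Open Scope classical_set_scope.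
Local Open Scope ring_scope.

(** Functions on an open set [U] are represented by total functions
    ['rV[R]_N -> R]; since [U] is open, all notions below that are relative to
    [U] depend only on the values taken in [U]. *)

Definition partial (R : realType) (N : nat) (i : 'I_N) (f : 'rV[R]_N -> R) :
    'rV[R]_N -> R :=
  fun x => 'D_(delta_mx 0 i) f x.

(** [partials [:: i1; ...; ik] f] is the derivative of [f] along [ik] first,
    and along [i1] last. *)
Definition partials (R : realType) (N : nat) (s : seq 'I_N)
    (f : 'rV[R]_N -> R) : 'rV[R]_N -> R :=
  foldr (@partial R N) f s.

Definition is_Ck (R : realType) (N k : nat) (U : set 'rV[R]_N)
    (f : 'rV[R]_N -> R) : Prop :=
  forall s : seq 'I_N, (size s <= k)%N ->
    (forall x, U x -> {for x, continuous (partials s f)}) /\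
    ((size s < k)%N ->
       forall i x, U x -> derivable (partials s f) x (delta_mx 0 i)).

Definition is_smooth (R : realType) (N : nat) (U : set 'rV[R]_N)
    (f : 'rV[R]_N -> R) : Prop :=
  forall k, is_Ck k U f.

(** Iterated Lebesgue integral.  It is only applied to continuous functions
    with compact support, for which, by Fubini, it is the integral with respect
    to the [n]-dimensional Lebesgue measure. *)
Fixpoint integral_rV (R : realType) (n : nat) : ('rV[R]_n -> R) -> R :=
  match n with
  | 0 => fun f => f 0
  | m.+1 => fun f =>
      \int[@lebesgue_measure R]_t
        integral_rV (fun y : 'rV[R]_m => f (row_mx (const_mx (t : R) : 'rV[R]_1) y))
  end.

Definition test_fun_in (R : realType) (N : nat) (K : set 'rV[R]_N)
    (phi : 'rV[R]_N -> R) : Prop :=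
  is_smooth setT phi /\ forall x, ~ K x -> phi x = 0.

Definition test_fun (R : realType) (N : nat) (U : set 'rV[R]_N)
    (phi : 'rV[R]_N -> R) : Prop :=
  exists K : set 'rV[R]_N, [/\ compact K, K `<=` U & test_fun_in K phi].

Definition test_norm (R : realType) (N : nat) (m : nat) (K : set 'rV[R]_N)
    (phi : 'rV[R]_N -> R) : R :=
  \sum_(k < m.+1) \sum_(s : k.-tuple 'I_N)
    sup [set `|partials s phi x| | x in K].

(** A functional is represented by a total map on functions; only its values on
    test functions are meaningful. *)
Definition functional (R : realType) (N : nat) : Type :=
  ('rV[R]_N -> R) -> R.

Definition is_distribution (R : realType) (N : nat) (U : set 'rV[R]_N)
    (T : functional R N) : Prop :=
  (forall (a : R) (phi psi : 'rV[R]_N -> R), test_fun U phi -> test_fun U psi ->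
     T (fun x => a * phi x + psi x) = a * T phi + T psi) /\
  (forall K : set 'rV[R]_N, compact K -> K `<=` U ->
     exists (m : nat) (C : R), forall phi, test_fun_in K phi ->
       `|T phi| <= C * test_norm m K phi).

(** [T] coincides on [U] with the distribution associated with [f]. *)
Definition distr_eq_fun (R : realType) (N : nat) (U : set 'rV[R]_N)
    (T : functional R N) (f : 'rV[R]_N -> R) : Prop :=
  forall phi, test_fun U phi -> T phi = integral_rV (fun x => f x * phi x).

Definition distr_mul (R : realType) (N : nat) (g : 'rV[R]_N -> R)
    (T : functional R N) : functional R N :=
  fun phi => T (fun x => g x * phi x).

Definition distr_partial (R : realType) (N : nat) (i : 'I_N)
    (T : functional R N) : functional R N :=
  fun phi => - T (partial i phi).

(** An operator is given here through its action on distributions. *)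
Definition hypoelliptic (R : realType) (N : nat)
    (P : functional R N -> functional R N) (Omega : set 'rV[R]_N) : Prop :=
  forall T : functional R N, is_distribution Omega T ->
  forall U : set 'rV[R]_N, open U -> U `<=` Omega ->
  forall f : 'rV[R]_N -> R, is_smooth U f ->
    distr_eq_fun U (P T) f ->
    exists g : 'rV[R]_N -> R, is_smooth U g /\ distr_eq_fun U T g.

(** The same operator [1/V sum_ij D_i (V a_ij D_j)], acting on C^2 functions and
    on distributions. *)
Definition opL (R : realType) (N : nat) (V : 'rV[R]_N -> R)
    (A : 'rV[R]_N -> 'M[R]_N) (u : 'rV[R]_N -> R) : 'rV[R]_N -> R :=
  fun x => (V x)^-1 *
    \sum_i \sum_j partial i (fun y => V y * A y i j * partial j u y) x.

Definition distr_opL (R : realType) (N : nat) (V : 'rV[R]_N -> R)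
    (A : 'rV[R]_N -> 'M[R]_N) (T : functional R N) : functional R N :=
  distr_mul (fun x => (V x)^-1) (fun phi =>
    \sum_i \sum_j
      distr_partial i (distr_mul (fun y => V y * A y i j) (distr_partial j T))
        phi).

Definition opLc (R : realType) (N : nat) (V : 'rV[R]_N -> R)
    (A : 'rV[R]_N -> 'M[R]_N) (c u : 'rV[R]_N -> R) : 'rV[R]_N -> R :=
  fun x => opL V A u x - c x * u x.

Definition pos_semidef (R : realType) (N : nat) (M : 'M[R]_N) : Prop :=
  forall v : 'rV[R]_N, 0 <= (v *m M *m v^T) 0 0.

Definition max_at (R : realType) (N : nat) (U : set 'rV[R]_N)
    (u : 'rV[R]_N -> R) (x0 : 'rV[R]_N) : Prop :=
  U x0 /\ forall x, U x -> u x <= u x0.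

Definition constant_on (R : realType) (N : nat) (U : set 'rV[R]_N)
    (u : 'rV[R]_N -> R) : Prop :=
  exists k : R, forall x, U x -> u x = k.

(* Main.v *)
Require Import Defs.
From HB Require Import structures.
From mathcomp Require Import all_boot all_order all_algebra.
From mathcomp Require Import all_classical all_reals all_analysis.
From mathcomp Require Import ring lra.

(** Write [b = V A] and [opDiv b f = sum_ij D_i (b_ij D_j f)], so that
    [L = V^-1 opDiv b] and [opDiv b] is formally self-adjoint. Both parts of the
    theorem follow from one statement about a function [u] with a maximum at [x0]
    and [L u >= c (u - u x0)]: the function [w = u - u x0] is nonpositive, of
    class C^2, and [opDiv b w >= V c w]. Its zero set is nonempty and closed in
    [Omega], and the point is that it is open ([zero_set_open]).

    The only comparison principle for a degenerate operator that is used directly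
    is the classical one at an interior maximum ([opDiv_le0_at_max]), as
    follows. Fix a cube around a point [y], with a function
    [psi] such that [opDiv b psi >= 1] there; it exists because [A y <> 0]
    ([barrier]). Let [Z] be a closed subset of the cube, such as the zero set of
    [w], all of whose complement is penalized: off [Z] there are nonpositive
    functions [w'], vanishing on [Z], with [opDiv b w' >= kappa w']. Adding large
    multiples of such functions to a test function [phi] forces the maximum to lie
    near [Z], and yields the estimate [phi <= C sup_Z (opDiv b phi)^-] on [Z]
    ([penalizable_estimate]): only the values of [opDiv b phi] on [Z] matter.

    By the Hahn-Banach theorem this estimate provides Green functionals carried
    by [Z]: for a linear form [l] such as [phi |-> phi y] or
    [phi |-> \int f phi] with [f >= 0] supported in [Z], a positive distribution
    [T] supported by [Z] with [opDiv b T = - l] ([green_functional]). This is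
    where hypoellipticity comes in, and it is used twice.

    If [f] is a bump supported in the interior of [Z], then [T] is a smooth
    function [h >= 0] that vanishes off [Z], and is positive where [f] is, by the
    classical maximum principle ([potential_gt0]). So [- h] penalizes interior
    points of [Z] with respect to the frontier of [Z], and the frontier is
    itself a penalizable set.

    If [l] is the evaluation at [y], then [T] is smooth off [y] and vanishes off
    [Z]. When [Z] has empty interior, [T] vanishes off [y] altogether, which is
    incompatible with [opDiv b T] being minus the Dirac mass at [y]. So no
    penalizable set with empty interior contains [y] ([penalizable_interior]).
    Applied to the frontier of the zero set of [w], this shows that the frontier
    is empty. *)

Import Order.TTheory GRing.Theory Num.Theory.
Import numFieldNormedType.Exports.

Local Open Scope classical_set_scope.
Local Open Scope ring_scope.

(** * Functions of class C^k *)

Lemma is_Ck0 {R : realType} {N} (U : set 'rV[R]_N) f :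
  is_Ck 0 U f <-> forall x, U x -> {for x, continuous f}.
Proof.
split=> [H x Ux|H s]; first exact: (H [::] isT).1.
by case: s => // _; split.
Qed.

(** [partials] differentiates along the head of its list last, so that peeling
    off the derivative taken first amounts to removing the last index. *)
Lemma is_CkS {R : realType} {N k} (U : set 'rV[R]_N) f : is_Ck k.+1 U f <->
  [/\ forall x, U x -> {for x, continuous f},
      forall i x, U x -> derivable f x (delta_mx 0 i) &
      forall i, is_Ck k U (partial i f)].
Proof.
split=> [H|[cf df Hp] s].
  split; [exact: (H [::] isT).1 | exact: (H [::] isT).2 |].
  move=> i s sk; have := H (rcons s i); rewrite size_rcons !ltnS /partials.
  by rewrite foldr_rcons; apply.
case/lastP: s => [|s i]; first by move=> _; split.
by rewrite size_rcons !ltnS /partials foldr_rcons => sk; exact: Hp.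
Qed.

Lemma is_Ck_cont {R : realType} {N k} {U : set 'rV[R]_N} {f} :
  is_Ck k U f -> forall x, U x -> {for x, continuous f}.
Proof. by move=> H; exact: (H [::] isT).1. Qed.

Lemma is_CkW {R : realType} {N k l} {U : set 'rV[R]_N} {f} :
  (k <= l)%N -> is_Ck l U f -> is_Ck k U f.
Proof.
move=> kl H s sk; have [cs ds] := H s (leq_trans sk kl).
by split=> // sk'; apply: ds; exact: leq_trans kl.
Qed.

Lemma is_Ck_sub {R : realType} {N k} {U W : set 'rV[R]_N} {f} :
  U `<=` W -> is_Ck k W f -> is_Ck k U f.
Proof.
move=> UW H s sk; have [cs ds] := H s sk; split=> [x /UW|sk' i x /UW].
  exact: cs.
exact: ds.
Qed.

Lemma is_Ck_setU {R : realType} {N k} {U W : set 'rV[R]_N} {f} :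
  is_Ck k U f -> is_Ck k W f -> is_Ck k (U `|` W) f.
Proof.
move=> HU HW s sk; have [cU dU] := HU s sk; have [cW dW] := HW s sk.
by split=> [x []|sk' i x []]; [exact: cU|exact: cW|exact: dU|exact: dW].
Qed.

#[local] Opaque is_Ck.

Lemma is_Ck_derivable {R : realType} {N k} {U : set 'rV[R]_N} {f} :
  is_Ck k.+1 U f -> forall i x, U x -> derivable f x (delta_mx 0 i).
Proof. by move=> /is_CkS[_ + _]; exact. Qed.

Lemma is_Ck_partial {R : realType} {N k} {U : set 'rV[R]_N} {f} :
  is_Ck k.+1 U f -> forall i, is_Ck k U (partial i f).
Proof. by move=> /is_CkS[_ _]; exact. Qed.

Lemma is_Ck_is_derive {R : realType} {N k} {U : set 'rV[R]_N} {f} :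
  is_Ck k.+1 U f -> forall i x, U x ->
  is_derive x (delta_mx 0 i) f (partial i f x).
Proof. by move=> H i x Ux; exact: derivableP (is_Ck_derivable H i x Ux). Qed.

Lemma open_near_eq {R : realType} {N} {T : Type} {U : set 'rV[R]_N}
    {f g : 'rV[R]_N -> T} {x} :
  open U -> {in U, f =1 g} -> U x -> \forall y \near x, f y = g y.
Proof.
move=> oU fg Ux; apply: filterS (open_nbhs_nbhs (conj oU Ux)) => y Uy.
by apply: fg; rewrite inE.
Qed.

Lemma near_eq_continuous {T : topologicalType} {S : topologicalType} (f g : T -> S) x :
  (\forall y \near x, f y = g y) -> {for x, continuous f} ->
  {for x, continuous g}.
Proof.
move=> fg cf; rewrite /prop_for /continuous_at -(nbhs_singleton fg).
by apply: cvg_trans cf; apply: near_eq_cvg.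
Qed.

Lemma partial_eq_on {R : realType} {N} {U : set 'rV[R]_N} {f g} i :
  open U -> {in U, f =1 g} -> {in U, partial i f =1 partial i g}.
Proof.
move=> oU fg x; rewrite inE => Ux.
by apply: near_eq_derive; exact: open_near_eq fg Ux.
Qed.

Lemma is_Ck_eq_on {R : realType} {N k} {U : set 'rV[R]_N} {f g} :
  open U -> {in U, f =1 g} -> is_Ck k U f -> is_Ck k U g.
Proof.
move=> oU; elim: k f g => [|k IH] f g fg.
  move=> /is_Ck0 cf; apply/is_Ck0 => x Ux.
  exact: near_eq_continuous (open_near_eq oU fg Ux) (cf x Ux).
move=> /is_CkS[cf df pf]; apply/is_CkS; split.
- move=> x Ux; exact: near_eq_continuous (open_near_eq oU fg Ux) (cf x Ux).
- move=> i x Ux; apply: near_eq_derivable (df i x Ux).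
  exact: open_near_eq fg Ux.
- by move=> i; apply: IH (pf i); exact: partial_eq_on.
Qed.

(** The form in which smoothness is proved below, by induction on [k]: the
    candidate partial derivatives are given by an explicit formula. *)
Lemma is_CkS_intro {R : realType} {N k} {U : set 'rV[R]_N} {f}
    (df : 'I_N -> 'rV[R]_N -> R) : open U ->
  (forall i x, U x -> is_derive x (delta_mx 0 i) f (df i x)) ->
  (forall x, U x -> {for x, continuous f}) ->
  (forall i, is_Ck k U (df i)) -> is_Ck k.+1 U f.
Proof.
move=> oU fdf cf Hdf; apply/is_CkS; split; first exact: cf.
  by move=> i x Ux; have [] := fdf i x Ux.
move=> i; apply: (is_Ck_eq_on oU _ (Hdf i)) => x; rewrite inE => Ux.
by have [_ <-] := fdf i x Ux.
Qed.

Lemma is_Ck_cst {R : realType} {N k} {U : set 'rV[R]_N} (a : R) :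
  open U -> is_Ck k U (fun=> a).
Proof.
move=> oU; elim: k a => [|k IH] a.
  by apply/is_Ck0 => x _; exact: cst_continuous.
apply: (is_CkS_intro (fun _ _ => 0) oU).
- by move=> x Ux; exact: cst_continuous.
- by move=> i; exact: IH.
Qed.

Lemma is_CkD {R : realType} {N k} {U : set 'rV[R]_N} {f g} : open U ->
  is_Ck k U f -> is_Ck k U g -> is_Ck k U (fun x => f x + g x).
Proof.
move=> oU; elim: k f g => [|k IH] f g Hf Hg.
  apply/is_Ck0 => x Ux.
  by apply: continuousD; [exact: is_Ck_cont Hf _ Ux|exact: is_Ck_cont Hg _ Ux].
apply: (is_CkS_intro (fun i x => partial i f x + partial i g x) oU).
- move=> i x Ux.
  have df := is_Ck_is_derive Hf i x Ux; have dg := is_Ck_is_derive Hg i x Ux.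
  exact: is_deriveD.
- move=> x Ux.
  by apply: continuousD; [exact: is_Ck_cont Hf _ Ux|exact: is_Ck_cont Hg _ Ux].
- by move=> i; exact: IH (is_Ck_partial Hf i) (is_Ck_partial Hg i).
Qed.

Lemma is_CkM {R : realType} {N k} {U : set 'rV[R]_N} {f g} : open U ->
  is_Ck k U f -> is_Ck k U g -> is_Ck k U (fun x => f x * g x).
Proof.
move=> oU; elim: k f g => [|k IH] f g Hf Hg.
  apply/is_Ck0 => x Ux.
  by apply: continuousM; [exact: is_Ck_cont Hf _ Ux|exact: is_Ck_cont Hg _ Ux].
apply: (is_CkS_intro
  (fun i x => f x * partial i g x + g x * partial i f x) oU).
- move=> i x Ux.
  have df := is_Ck_is_derive Hf i x Ux; have dg := is_Ck_is_derive Hg i x Ux.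
  exact: is_deriveM.
- move=> x Ux.
  by apply: continuousM; [exact: is_Ck_cont Hf _ Ux|exact: is_Ck_cont Hg _ Ux].
- move=> i; have IHf := IH _ _ (is_CkW (leqnSn k) Hf) (is_Ck_partial Hg i).
  have IHg := IH _ _ (is_CkW (leqnSn k) Hg) (is_Ck_partial Hf i).
  exact: is_CkD oU IHf IHg.
Qed.

Lemma is_CkV {R : realType} {N k} {U : set 'rV[R]_N} {f} : open U ->
  (forall x, U x -> f x != 0) -> is_Ck k U f -> is_Ck k U (fun x => (f x)^-1).
Proof.
move=> oU f0; elim: k => [|k IH] Hf.
  apply/is_Ck0 => x Ux.
  by apply: continuousV; [exact: f0|exact: is_Ck_cont Hf _ Ux].
apply: (is_CkS_intro
  (fun i x => - 1 * ((f x)^-1 * (f x)^-1) * partial i f x) oU).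
- move=> i x Ux; have df := is_Ck_derivable Hf i x Ux.
  apply: DeriveDef; first by apply: derivableV => //; exact: f0.
  rewrite deriveV //; last exact: f0.
  by rewrite mulN1r -invfM -expr2.
- by move=> x Ux; apply: continuousV; [exact: f0|exact: is_Ck_cont Hf _ Ux].
- have Hf' := IH (is_CkW (leqnSn _) Hf).
  move=> i; apply: (is_CkM oU) (is_Ck_partial Hf i).
  exact: is_CkM oU (is_Ck_cst (- 1) oU) (is_CkM oU Hf' Hf').
Qed.

Lemma is_CkZ {R : realType} {N k} {U : set 'rV[R]_N} (a : R) {f} : open U ->
  is_Ck k U f -> is_Ck k U (fun x => a * f x).
Proof. by move=> oU; apply: (is_CkM oU); exact: is_Ck_cst. Qed.

Lemma is_CkN {R : realType} {N k} {U : set 'rV[R]_N} {f} : open U ->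
  is_Ck k U f -> is_Ck k U (fun x => - f x).
Proof.
move=> oU Hf; apply: (is_Ck_eq_on oU _ (is_CkZ (-1) oU Hf)) => x _.
by rewrite mulN1r.
Qed.

Lemma is_CkB {R : realType} {N k} {U : set 'rV[R]_N} {f g} : open U ->
  is_Ck k U f -> is_Ck k U g -> is_Ck k U (fun x => f x - g x).
Proof. by move=> oU Hf Hg; exact: is_CkD oU Hf (is_CkN oU Hg). Qed.

Lemma is_Ck_sum {R : realType} {N k} {U : set 'rV[R]_N} (I : Type)
    (r : seq I) {F : I -> 'rV[R]_N -> R} : open U ->
  (forall i, is_Ck k U (F i)) -> is_Ck k U (fun x => \sum_(i <- r) F i x).
Proof.
move=> oU HF; elim: r => [|i r IH].
  by apply: (is_Ck_eq_on oU _ (is_Ck_cst 0 oU)) => x _; rewrite big_nil.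
by apply: (is_Ck_eq_on oU _ (is_CkD oU (HF i) IH)) => x _; rewrite big_cons.
Qed.

Lemma is_Ck_prod {R : realType} {N k} {U : set 'rV[R]_N} (I : Type)
    (r : seq I) {F : I -> 'rV[R]_N -> R} : open U ->
  (forall i, is_Ck k U (F i)) -> is_Ck k U (fun x => \prod_(i <- r) F i x).
Proof.
move=> oU HF; elim: r => [|i r IH].
  by apply: (is_Ck_eq_on oU _ (is_Ck_cst 1 oU)) => x _; rewrite big_nil.
by apply: (is_Ck_eq_on oU _ (is_CkM oU (HF i) IH)) => x _; rewrite big_cons.
Qed.

Lemma is_derive_coord {R : realType} {N} (i j : 'I_N) (x : 'rV[R]_N) :
  is_derive x (delta_mx 0 i) (fun y : 'rV[R]_N => y 0 j) (i == j)%:R.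
Proof.
have E : (fun h : R => h^-1 *: (((fun y : 'rV[R]_N => y 0 j) \o shift x)
    (h *: delta_mx 0 i) - x 0 j)) @ 0^' --> ((i == j)%:R : R).
  apply: (@cvg_trans _ ((fun=> (i == j)%:R : R) @ 0^')); last exact: cvg_cst.
  apply: near_eq_cvg; near=> h.
  rewrite /= !mxE eqxx /= eq_sym addrK -[LHS]mul1r -[_ *: _]/(_ * _).
  rewrite mulrA mulVf ?mul1r//.
  by near: h; exact: nbhs_dnbhs_neq.
by apply: DeriveDef; [apply/cvg_ex; eexists; exact: E|exact: cvg_lim E].
Unshelve. all: by end_near. Qed.

Lemma is_Ck_coord {R : realType} {N k} {U : set 'rV[R]_N} (j : 'I_N) :
  open U -> is_Ck k U (fun y : 'rV[R]_N => y 0 j).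
Proof.
move=> oU; case: k => [|k].
  by apply/is_Ck0 => x Ux; exact: coord_continuous.
apply: (is_CkS_intro (fun i _ => (i == j)%:R) oU).
- by move=> i x _; exact: is_derive_coord.
- by move=> x _; exact: coord_continuous.
- by move=> i; exact: is_Ck_cst.
Qed.

(** * Cubes and smooth cutoff functions *)

Lemma rV_normP {R : realType} {N} (x : 'rV[R]_N) (r : R) : 0 <= r ->
  `|x| <= r <-> forall i, `|x 0 i| <= r.
Proof.
move=> r0; have -> : `|x| = \big[Num.max/0]_ij `|x ij.1 ij.2| by rewrite -mx_normrE.
split.
  by move=> /bigmax_leP[_ H] i; exact: (H (0, i)).
by move=> H; apply/bigmax_leP; split=> // -[i j] _ /=; rewrite ord1.
Qed.

Lemma rV_norm_ltP {R : realType} {N} (x : 'rV[R]_N) (r : R) : 0 < r ->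
  `|x| < r <-> forall i, `|x 0 i| < r.
Proof.
move=> r0; have -> : `|x| = \big[Num.max/0]_ij `|x ij.1 ij.2| by rewrite -mx_normrE.
split.
  by move=> /bigmax_ltP[_ H] i; exact: (H (0, i)).
by move=> H; apply/bigmax_ltP; split=> // -[i j] _ /=; rewrite ord1.
Qed.

Lemma rV_compact_closed {R : realType} {N} {K : set 'rV[R]_N} : compact K -> closed K.
Proof. by apply: compact_closed; exact: norm_hausdorff. Qed.

Lemma rV_compact_bounded {R : realType} {N} {K : set 'rV[R]_N} :
  compact K -> exists2 r : R, 0 < r & forall x, K x -> `|x| < r.
Proof.
move=> /compact_bounded[M [_ HM]]; exists (`|M| + 2); first by rewrite ltr_wpDl.
move=> x Kx; apply: (@le_lt_trans _ _ (`|M| + 1)).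
  by apply: (HM _ _ x Kx); rewrite (le_lt_trans (ler_norm M))// ltrDl.
by rewrite ltrD2l ltr1n.
Qed.

Lemma cube_compact {R : realType} {N} (y : 'rV[R]_N) (r : R) :
  compact [set x | `|x - y| <= r].
Proof.
apply: bounded_closed_compact.
  exists (`|y| + r); split; first exact: num_real.
  move=> M rM x /= xy; apply: le_trans (ltW rM).
  by rewrite -[x](subrK y) addrC (le_trans (ler_normD _ _))// lerD2l.
have -> : [set x | `|x - y| <= r] = (fun x => `|x - y|) @^-1` [set t | t <= r] by [].
apply: preimage_closed (@closed_le _ _) => x _.
move=> B /nbhs_ballP[e e0 HB]; apply/nbhs_ballP; exists e => // z.
rewrite -ball_normE /= => xz; apply: HB; rewrite -ball_normE /=.
apply: le_lt_trans xz; by rewrite (le_trans (ler_dist_dist _ _))// opprB addrA subrK.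
Qed.

Lemma cube_open {R : realType} {N} (y : 'rV[R]_N) (r : R) :
  open [set x | `|x - y| < r].
Proof.
have -> : [set x : 'rV[R]_N | `|x - y| < r] = ball y r.
  by rewrite -ball_normE; apply/seteqP; split=> x /=; rewrite distrC.
exact: ball_open.
Qed.

Lemma is_derive_lineP {R : realType} {V : normedModType R} (f : V -> R) x v d :
  is_derive x v f d <-> is_derive (0 : R) 1 (fun h : R => f (h *: v + x)) d.
Proof.
have E : (fun h : R => h^-1 *: ((f \o shift x) (h *: v) - f x)) =
    (fun h : R => h^-1 *: (((fun h : R => f (h *: v + x)) \o shift 0) (h *: 1)
      - f (0 *: v + x))).
  by apply/funext => h /=; rewrite addr0 scale0r add0r [_%:A]mulr1.
split=> -[]; rewrite /derivable /derive => dv <-; (apply: DeriveDef;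
  [|by rewrite /derive E]); rewrite /derivable.
  by rewrite -E.
by rewrite E.
Qed.

Lemma is_derive_line {R : realType} {V : normedModType R} (f : V -> R)
    (x v : V) (t d : R) :
  is_derive (x + t *: v) v f d -> is_derive t 1 (fun h : R => f (x + h *: v)) d.
Proof.
move=> /is_derive_lineP H; apply/is_derive_lineP.
suff <- : (fun h : R => f (h *: v + (x + t *: v))) =
    (fun h : R => f (x + (h *: 1 + t) *: v)) by [].
by apply/funext => h; rewrite scalerDl [_%:A]mulr1 addrCA.
Qed.

Lemma is_derive_comp_dir {R : realType} {V : normedModType R} (F : R -> R)
    (q : V -> R) x v a d :
  is_derive (q x) 1 F a -> is_derive x v q d -> is_derive x v (F \o q) (a * d).
Proof.
move=> dF /is_derive_lineP dq; apply/is_derive_lineP.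
have dF' : is_derive (q (0 *: v + x)) 1 F a by rewrite scale0r add0r.
exact: is_derive1_comp dF' dq.
Qed.

(** The functions [t^-n exp (-1/t)], extended by 0 to [t <= 0]. The derivative
    of each is a combination of later ones, which makes smoothness provable by
    an induction on the order that treats all of them at once. *)
Section flat.
Context {R : realType}.

Definition flat (n : nat) (t : R) : R :=
  if 0 < t then t ^- n * expR (- t^-1) else 0.

Lemma flat_le0 n t : t <= 0 -> flat n t = 0.
Proof. by rewrite /flat leNgt => /negbTE ->. Qed.

Lemma flat_ge0 n t : 0 <= flat n t.
Proof.
rewrite /flat; case: ifPn => // t0.
by rewrite mulr_ge0 ?expR_ge0// invr_ge0 exprn_ge0// ltW.
Qed.

Lemma flat_gt0 n t : 0 < t -> 0 < flat n t.
Proof. by move=> t0; rewrite /flat t0 mulr_gt0 ?expR_gt0// invr_gt0 exprn_gt0. Qed.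

Lemma flatS n t : flat n t = flat n.+1 t * t.
Proof.
rewrite /flat; case: ifPn => [t0|]; last by rewrite mul0r.
by rewrite -!exprVn exprSr mulrAC mulfVK ?gt_eqF.
Qed.

(** From [s^(n+1) / (n+1)! <= exp s] at [s = 1/t]. *)
Lemma flat_le n t : `|flat n t| <= n.+1`!%:R * `|t|.
Proof.
rewrite ger0_norm ?flat_ge0//; case: (leP t 0) => t0.
  by rewrite flat_le0// mulr_ge0.
rewrite gtr0_norm// /flat t0 expRN.
have s0 : 0 <= t^-1 by rewrite invr_ge0 ltW.
rewrite ler_pdivrMr ?expR_gt0//.
have H : t^-1 ^+ n.+1 <= n.+1`!%:R * expR t^-1.
  rewrite -ler_pdivrMl ?ltr0n ?fact_gt0// mulrC.
  by apply: le_trans (expR_ge1Dxn n s0); rewrite lerDr.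
have -> : t ^- n = t * t^-1 ^+ n.+1.
  by rewrite exprS mulrA mulfV ?gt_eqF// mul1r exprVn.
by rewrite mulrAC mulrC ler_pM2r.
Qed.

Lemma flat_cont0 n : {for 0, continuous (flat n)}.
Proof.
rewrite /prop_for /continuous_at flat_le0//.
apply/cvgr0Pnorm_lt => e e0; near=> t.
apply: le_lt_trans (flat_le n t) _.
rewrite -ltr_pdivlMl ?ltr0n ?fact_gt0//.
near: t; exists (n.+1`!%:R^-1 * e) => /=.
  by rewrite mulr_gt0 ?invr_gt0 ?ltr0n ?fact_gt0.
by move=> z; rewrite /ball_ /= sub0r normrN.
Unshelve. all: by end_near. Qed.

(** At 0 the factorization [flatS] is a Caratheodory slope. *)
Lemma is_derive_flat (n : nat) (t : R) :
  is_derive t 1 (flat n) (- n%:R * flat n.+1 t + flat n.+2 t).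
Proof.
case: (ltrgtP t 0) => t0.
- rewrite !flat_le0 ?ltW// mulr0 addr0.
  apply: (near_eq_is_derive (f := cst 0)).
  have t1 : \forall s \near t, s < 0 by exact: lt_nbhsl.
  by apply: filterS t1 => s s0; rewrite flat_le0 ?ltW.
- apply: (near_eq_is_derive (f := fun s : R => (s^-1) ^+ n * expR (- s^-1))).
    near=> s; rewrite /flat ifT ?exprVn//.
    by near: s; exact: lt_nbhsr.
  have dV : is_derive t 1 (fun s : R => s^-1) (- t ^- 2).
    have tn0 : (@id R) t != 0 by rewrite gt_eqF.
    have := is_deriveV tn0 (is_derive_id t (1 : R)).
    by rewrite [_ *: _]mulr1.
  have dE : is_derive t 1 (fun s : R => expR (- s^-1)) (expR (- t^-1) * t ^- 2).
    have dN := is_deriveN dV; rewrite opprK in dN.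
    exact: (@is_derive1_comp _ expR (fun s => - s^-1) t _ _ (is_derive_expR _) dN).
  have dX : is_derive t 1 (fun s : R => s^-1 ^+ n) (n%:R * t^-1 ^+ n.-1 * - t ^- 2).
    by have := is_deriveX n dV; rewrite exprfctE.
  apply: (is_derive_eq (is_deriveM dX dE)).
  rewrite /flat t0 -!exprVn /=.
  rewrite -![_ *: _]/(_ * _).
  case: n {dX} => [|n]; rewrite /= !exprS ?expr0; ring.
- rewrite t0 !flat_le0// mulr0 addr0; apply/is_derive1_caratheodory.
  exists (flat n.+1); split; [|exact: flat_cont0|exact: flat_le0].
  by move=> s; rewrite (@flat_le0 n 0)// !subr0; exact: flatS.
Unshelve. all: by end_near. Qed.

Lemma flat_cont n : continuous (flat n).
Proof.
by move=> t; have [d _] := is_derive_flat n t;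
  exact/differentiable_continuous/derivable1_diffP.
Qed.

End flat.

Lemma is_Ck_flat {R : realType} {N k} {U : set 'rV[R]_N} n {q} : open U ->
  is_Ck k U q -> is_Ck k U (fun x => flat n (q x)).
Proof.
move=> oU; elim: k n => [|k IH] n Hq.
  apply/is_Ck0 => x Ux; apply: continuous_comp; first exact: is_Ck_cont Hq _ Ux.
  exact: flat_cont.
apply: (is_CkS_intro (fun i x =>
  (- n%:R * flat n.+1 (q x) + flat n.+2 (q x)) * partial i q x) oU).
- move=> i x Ux.
  exact: is_derive_comp_dir (is_derive_flat n (q x)) (is_Ck_is_derive Hq i x Ux).
- move=> x Ux; apply: continuous_comp; first exact: is_Ck_cont Hq _ Ux.
  exact: flat_cont.
- move=> i; have Hq' := is_CkW (leqnSn k) Hq.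
  apply: (is_CkM oU) (is_Ck_partial Hq i).
  by apply: (is_CkD oU); [apply: (is_CkZ _ oU)|]; exact: IH.
Qed.

(** Since the norm is the sup norm, a product over the coordinates of cutoff
    functions of one variable does it; for these, with [q] the square of the
    distance, take [p1 / (p1 + p2)] where [p1 = flat 0 (r^2 - q)] and
    [p2 = flat 0 (q - r^2 / 4)] never vanish together. *)
Lemma smooth_cutoff {R : realType} {N} (y : 'rV[R]_N) (r : R) : 0 < r ->
  exists chi : 'rV[R]_N -> R, [/\ is_smooth setT chi,
    forall x, 0 <= chi x,
    forall x, `|x - y| < r -> 0 < chi x,
    forall x, r <= `|x - y| -> chi x = 0 &
    forall x, `|x - y| <= r / 2 -> chi x = 1].
Proof.
move=> r0.
pose q (i : 'I_N) (x : 'rV[R]_N) : R := (x 0 i - y 0 i) * (x 0 i - y 0 i).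
pose p1 i x := flat 0 (r * r - q i x); pose p2 i x := flat 0 (q i x - r * r / 4).
have qE i x : q i x = `|x 0 i - y 0 i| ^+ 2 by rewrite real_normK ?num_real.
have den i x : 0 < p1 i x + p2 i x.
  case: (ltP (q i x) (r * r)) => h.
    by rewrite ltr_wpDr ?flat_ge0// flat_gt0// subr_gt0.
  rewrite ltr_wpDl ?flat_ge0// flat_gt0// subr_gt0; apply: lt_le_trans h.
  by rewrite ltr_pdivrMr// ltr_pMr ?mulr_gt0// ltr1n.
pose c i x := p1 i x / (p1 i x + p2 i x).
exists (fun x => \prod_i c i x); split.
- move=> k; apply: is_Ck_prod openT _ => i.
  have sq : is_Ck k setT (q i).
    by apply: (is_CkM openT); apply: (is_CkB openT);
      first [exact: is_Ck_coord openT|exact: is_Ck_cst openT].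
  have s1 : is_Ck k setT (p1 i).
    by apply: (is_Ck_flat _ openT); exact: is_CkB openT (is_Ck_cst _ openT) sq.
  have s2 : is_Ck k setT (p2 i).
    by apply: (is_Ck_flat _ openT); exact: is_CkB openT sq (is_Ck_cst _ openT).
  apply: (is_CkM openT s1); apply: (is_CkV openT); last exact: is_CkD openT s1 s2.
  by move=> x _; rewrite gt_eqF.
- by move=> x; apply: prodr_ge0 => i _; rewrite divr_ge0 ?flat_ge0// ltW.
- move=> x /rV_norm_ltP-/(_ r0) H; apply: prodr_gt0 => i _.
  rewrite divr_gt0// flat_gt0// subr_gt0 qE -expr2.
  by have := H i; rewrite !mxE => h; rewrite ltr_pXn2r// ?nnegrE// ltW.
- move=> x; rewrite leNgt => /negP H.
  have [i hi] : exists i, r <= `|x 0 i - y 0 i|.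
    apply: contrapT => /forallNP Hn; apply: H; apply/(rV_norm_ltP _ _ r0) => i.
    by rewrite !mxE ltNge; apply/negP; exact: Hn.
  rewrite (bigD1 i)//= /c /p1 flat_le0 ?mul0r// subr_le0 qE -expr2.
  by rewrite ler_pXn2r// ?nnegrE// ltW.
- have r20 : 0 <= r / 2 by rewrite divr_ge0// ltW.
  move=> x /rV_normP-/(_ r20) H; apply: big1 => i _.
  rewrite /c [p2 i x]flat_le0 ?addr0.
    rewrite divff// gt_eqF// flat_gt0// subr_gt0 qE -expr2.
    rewrite ltr_pXn2r// ?nnegrE ?ltW//; have := H i; rewrite !mxE => h.
    by apply: le_lt_trans h _; rewrite ltr_pdivrMr// ltr_pMr// ltr1n.
  rewrite subr_le0 qE; have -> : r * r / 4 = (r / 2) ^+ 2 by field.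
  by rewrite ler_pXn2r// ?nnegrE//; have := H i; rewrite !mxE.
Qed.

(** * Necessary conditions at a maximum *)

Lemma is_derive_continuous {R : realType} {f : R -> R} {t d : R} :
  is_derive t 1 f d -> {for t, continuous f}.
Proof. by move=> [df _]; exact/differentiable_continuous/derivable1_diffP. Qed.

(** Increments of both signs occur in the difference quotients that this bounds. *)
Lemma MVT_symmetric {R : realType} (f df : R -> R) (h : R) :
  (forall s : R, `|s| <= `|h| -> is_derive s 1 f (df s)) ->
  exists2 c : R, `|c| <= `|h| & f h - f 0 = df c * h.
Proof.
move=> H; case: (leP 0 h) => h0.
- have Hs (s : R) : 0 <= s <= h -> `|s| <= `|h|.
    by move=> /andP[s0 sh]; rewrite !ger0_norm.
  have [||c] := @MVT_segment R f df 0 h h0.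
  + by move=> s /[!in_itv]/= /andP[s0 sh]; apply: H; apply: Hs; rewrite !ltW.
  + apply: continuous_in_subspaceT => s; rewrite inE/= in_itv/= => sh.
    exact: is_derive_continuous (H s (Hs s sh)).
  + by rewrite in_itv/= => ch; rewrite subr0 => E; exists c => //; exact: Hs.
- have Hs (s : R) : h <= s <= 0 -> `|s| <= `|h|.
    by move=> /andP[hs s0]; rewrite !ler0_norm ?lerN2// ltW.
  have [||c] := @MVT_segment R f df h 0 (ltW h0).
  + by move=> s /[!in_itv]/= /andP[s0 sh]; apply: H; apply: Hs; rewrite !ltW.
  + apply: continuous_in_subspaceT => s; rewrite inE/= in_itv/= => sh.
    exact: is_derive_continuous (H s (Hs s sh)).
  + rewrite in_itv/= => ch E; exists c; first exact: Hs.
    by rewrite -opprB E sub0r mulrN opprK.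
Qed.

Lemma is_deriveZdir {R : realType} {V : normedModType R} (f : V -> R) x v
    (t d : R) : is_derive x v f d -> is_derive x (t *: v) f (t * d).
Proof.
move=> /is_derive_lineP H; apply/is_derive_lineP.
have -> : (fun h : R => f (h *: (t *: v) + x)) =
    (fun h : R => f (h *: v + x)) \o (fun h => t * h).
  by apply/funext => h /=; rewrite scalerA mulrC.
rewrite mulrC; apply: is_derive1_comp; first by rewrite mulr0.
have := @is_deriveZ R R R id t 0 1 1 (is_derive_id (0 : R) (1 : R)).
by rewrite [_ *: _]mulr1.
Qed.

(** Moving along [w] and then along [e]: the increment along [e] is computed by
    the mean value theorem at points that tend to [x], so that continuity of
    the derivative along [e] suffices. *)
Lemma is_derive_addr {R : realType} {V : normedModType R} (f g : V -> R)
    (x w e : V) (a : R) : is_derive x w f a ->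
  (\forall y \near x, is_derive y e f (g y)) -> {for x, continuous g} ->
  is_derive x (w + e) f (a + g x).
Proof.
move=> dw de cg.
suff H : (fun h : R => h^-1 *: ((f \o shift x) (h *: (w + e)) - f x)) @ 0^' -->
    a + g x.
  by apply: DeriveDef; [apply/cvg_ex; eexists; exact: H|exact: cvg_lim H].
have -> : (fun h : R => h^-1 *: ((f \o shift x) (h *: (w + e)) - f x)) =
    (fun h : R => h^-1 *: ((f \o shift x) (h *: w) - f x) +
      h^-1 * (f (h *: e + (h *: w + x)) - f (0 *: e + (h *: w + x)))).
  apply/funext => h /=; rewrite -[h^-1 * _]/(h^-1 *: (_ : R)) -scalerDr.
  congr (_ *: _).
  by rewrite scale0r add0r [RHS]addrC addrA subrK scalerDr addrAC addrC addrA.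
apply: cvgD; first by case: dw => dw <-; exact: dw.
apply/cvgrPdist_le => eps eps0.
have /nbhs_ballP[d /= d0 Hd] : \forall y \near x,
    is_derive y e f (g y) /\ `|g x - g y| <= eps.
  near=> y; split; first by near: y.
  by near: y; move/cvgrPdist_le : cg; exact.
have D0 : 0 < d / (`|w| + `|e| + 1).
  by rewrite divr_gt0// ltr_wpDl// addr_ge0.
near=> h.
have h0 : h != 0 by near: h; exact: nbhs_dnbhs_neq.
have hd : `|h| < d / (`|w| + `|e| + 1).
  near: h; apply: nbhs_dnbhs; exists (d / (`|w| + `|e| + 1)) => //= z.
  by rewrite /ball_ /= sub0r normrN.
have Hb (s : R) : `|s| <= `|h| -> ball x d (s *: e + (h *: w + x)).
  move=> sh; rewrite -ball_normE /ball_ /=.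
  rewrite addrA opprD addrCA subrr addr0 normrN.
  apply: (@le_lt_trans _ _ (`|h| * (`|w| + `|e| + 1))); last first.
    by rewrite -ltr_pdivlMr// ltr_wpDl// addr_ge0.
  apply: le_trans (ler_normD _ _) _; rewrite !normrZ !mulrDr mulr1 addrC.
  apply: (@le_trans _ _ (`|h| * `|w| + `|h| * `|e|)); last by rewrite lerDl.
  by rewrite lerD2l ler_wpM2r.
have [|c ch] := @MVT_symmetric R (fun s : R => f (s *: e + (h *: w + x)))
    (fun s : R => g (s *: e + (h *: w + x))) h.
  move=> s /Hb/Hd[ds _].
  have /is_derive_line : is_derive (h *: w + x + s *: e) e f
      (g (s *: e + (h *: w + x))) by rewrite [in X in is_derive X]addrC.
  by under eq_fun do rewrite addrC.
move=> /= ->; rewrite mulrCA mulVf// mulr1.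
by have [_] := Hd _ (Hb c ch).
Unshelve. all: by end_near. Qed.

(** Reach the direction [v] by adding its coordinates one at a time. *)
Lemma is_Ck_is_derive_dir {R : realType} {N k} {U : set 'rV[R]_N} {f} :
  open U -> is_Ck k.+1 U f -> forall x v, U x ->
  is_derive x v f (\sum_i v 0 i * partial i f x).
Proof.
move=> oU Hf x v Ux; rewrite [X in is_derive x X](row_sum_delta v).
elim: (index_enum _) => [|i s IH].
  by rewrite !big_nil; exact: is_derive0.
rewrite !big_cons addrC [X in is_derive x _ f X]addrC.
apply: (@is_derive_addr _ _ f (fun y => v 0 i * partial i f y)) => //.
- apply: filterS (open_nbhs_nbhs (conj oU Ux)) => y Uy.
  exact: is_deriveZdir (is_Ck_is_derive Hf i y Uy).
- apply: continuousM; first exact: cst_continuous.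
  exact: is_Ck_cont (is_Ck_partial Hf i) x Ux.
Qed.

Lemma near_line {R : realType} {V : normedModType R} {U : set V} {x v : V} :
  open U -> U x -> exists2 d : R, 0 < d & forall t, `|t| < d -> U (x + t *: v).
Proof.
move=> oU Ux; have /nbhs_ballP[d /= d0 Hd] := open_nbhs_nbhs (conj oU Ux).
exists (d / (`|v| + 1)); first by rewrite divr_gt0// ltr_wpDl.
move=> t td; apply: Hd; rewrite -ball_normE /ball_ /= opprD addNKr normrN normrZ.
apply: (@le_lt_trans _ _ (`|t| * (`|v| + 1))); first by rewrite ler_wpM2l// lerDl.
by rewrite -ltr_pdivlMr// ltr_wpDl.
Qed.

Lemma partial_eq0_at_max {R : realType} {N k} {U : set 'rV[R]_N} {f} {y} :
  open U -> is_Ck k.+1 U f -> max_at U f y -> forall i, partial i f y = 0.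
Proof.
move=> oU Hf [Uy fmax] i.
have [d d0 Hd] := @near_line _ _ _ _ (delta_mx 0 i) oU Uy.
pose phi (t : R) := f (y + t *: delta_mx 0 i).
have dphi (t : R) : `|t| < d -> is_derive t 1 phi (partial i f (y + t *: delta_mx 0 i)).
  by move=> td; apply: is_derive_line; exact: is_Ck_is_derive Hf _ _ (Hd _ td).
have itvd (t : R) : t \in `]-d, d[ -> `|t| < d by rewrite in_itv/= ltr_norml.
have [] : is_derive (0 : R) 1 phi 0.
  apply: (@derive1_at_max _ phi (- d) d).
  - by rewrite -subr_ge0 opprK addr_ge0// ltW.
  - by move=> t /itvd/dphi[].
  - by rewrite in_itv/= oppr_lt0 d0.
  - by move=> t /itvd td; rewrite /phi scale0r addr0; apply: fmax; exact: Hd.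
have [] := dphi 0; first by rewrite normr0.
by move=> _; rewrite scale0r addr0 => <- _.
Qed.

(** The directional derivative [psi] of [f] along [v] vanishes at the maximum; if
    its own derivative along [v] were positive there, [psi] would be positive on
    a segment issued from [y], and [f] would increase along it. *)
Lemma hessian_le0_at_max {R : realType} {N k} {U : set 'rV[R]_N} {f} {y} :
  open U -> is_Ck k.+2 U f -> max_at U f y -> forall v : 'rV[R]_N,
  \sum_i \sum_j v 0 i * v 0 j * partial i (partial j f) y <= 0.
Proof.
move=> oU Hf fM v; have [Uy fmax] := fM.
have [d d0 Hd] := @near_line _ _ _ _ v oU Uy.
pose phi (t : R) := f (y + t *: v).
pose psi (x : 'rV[R]_N) := \sum_j v 0 j * partial j f x.
have dphi (t : R) : `|t| < d -> is_derive t 1 phi (psi (y + t *: v)).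
  move=> td; apply: is_derive_line.
  exact: is_Ck_is_derive_dir oU (is_CkW (leqnSn _) Hf) _ _ (Hd _ td).
have psi0 : psi y = 0.
  apply: big1 => j _; rewrite (partial_eq0_at_max oU (is_CkW (leqnSn _) Hf) fM).
  by rewrite mulr0.
have Hpsi : is_Ck k.+1 U psi.
  by apply: (is_Ck_sum _ _ oU) => j; apply: (is_CkZ _ oU); exact: is_Ck_partial.
set D := (X in X <= _).
have dpsi : is_derive y v psi D.
  have := is_Ck_is_derive_dir oU Hpsi y v Uy.
  suff -> : \sum_i v 0 i * partial i psi y = D by [].
  apply: eq_bigr => i _.
  have -> : partial i psi y = \sum_j v 0 j * partial i (partial j f) y.
    rewrite /partial /psi.
    have -> : (fun x => \sum_j v 0 j * 'D_(delta_mx 0 j) f x) =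
        \sum_j (v 0 j *: (fun x => partial j f x)).
      by apply/funext => x; rewrite fct_sumE; apply: eq_bigr.
    have dj j : derivable (fun x => partial j f x) y (delta_mx 0 i).
      exact: is_Ck_derivable (is_Ck_partial Hf j) i y Uy.
    rewrite derive_sum => [|j]; last exact: derivableZ.
    by apply: eq_bigr => j _; rewrite deriveZ.
  by rewrite mulr_sumr; apply: eq_bigr => j _; rewrite mulrA.
have /is_derive_line dpsi0 : is_derive (y + 0 *: v) v psi D by rewrite scale0r addr0.
rewrite leNgt; apply/negP => D0.
have [cD _] := dpsi0; move: (derive_val (is_derive := dpsi0)) => vD.
have cv : (fun h : R => h^-1 * psi (y + h *: v)) @ 0^' --> D.
  move: cD; rewrite /derivable => cD; rewrite -vD; apply: cvg_trans cD.
  apply: near_eq_cvg; apply: nearW => h /=.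
  by rewrite addr0 [_%:A]mulr1 scale0r addr0 psi0 subr0.
have : \forall h \near (0 : R)^', 0 < h^-1 * psi (y + h *: v).
  exact: (cvgr_gt D cv).
move=> /nbhs_ballP[e /= e0 He].
pose m := Num.min d e / 2.
have m0 : 0 < m by rewrite divr_gt0// lt_min d0.
have md : m < d.
  by rewrite ltr_pdivrMr// (@le_lt_trans _ _ d)// ?ge_min ?lexx// ltr_pMr// ltr1n.
have me : m < e.
  rewrite ltr_pdivrMr// (@le_lt_trans _ _ e)// ?ge_min ?lexx ?orbT//.
  by rewrite ltr_pMr// ltr1n.
have sd (s : R) : 0 <= s <= m -> `|s| < d.
  by move=> /andP[s0 sm]; rewrite ger0_norm//; exact: le_lt_trans md.
have [||c] := @MVT R phi (fun t => psi (y + t *: v)) 0 m m0.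
- move=> s; rewrite in_itv/= => /andP[s0 sm]; apply: dphi; apply: sd.
  by rewrite !ltW.
- apply: continuous_in_subspaceT => s; rewrite inE/= in_itv/= => sm.
  exact: is_derive_continuous (dphi s (sd s sm)).
rewrite in_itv/= => /andP[c0 cm] E.
have : 0 < phi m - phi 0.
  rewrite E subr0 mulr_gt0//.
  have : 0 < c^-1 * psi (y + c *: v).
    apply: He; last by rewrite gt_eqF.
    by rewrite -ball_normE /ball_ /= sub0r normrN gtr0_norm// (lt_trans cm).
  by rewrite pmulr_rgt0// invr_gt0.
rewrite /phi scale0r addr0 subr_gt0 ltNge => /negP; apply.
by apply: fmax; apply: Hd; apply: sd; rewrite lexx ltW.
Qed.

Section trace.
Context {R : realType} {N : nat}.
Implicit Types (B H : 'M[R]_N) (v w : 'rV[R]_N).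

Let bf B v w := (v *m B *m w^T) 0 0.

Let bfE B v w : bf B v w = \sum_i \sum_j v 0 i * w 0 j * B i j.
Proof.
rewrite /bf mxE exchange_big; apply: eq_bigr => j _.
rewrite !mxE mulr_suml; apply: eq_bigr => i _ /=.
by rewrite mulrAC.
Qed.

Let bf_line B v w t : B^T = B ->
  bf B (v + t *: w) (v + t *: w) = bf B v v + 2 * t * bf B w v + t ^+ 2 * bf B w w.
Proof.
move=> symB; have bfC : bf B v w = bf B w v.
  by rewrite /bf -[in LHS](trmxK (v *m B *m w^T)) [LHS]mxE !trmx_mul trmxK symB mulmxA.
rewrite /bf linearD/= linearZ/= !mulmxDl !mulmxDr -!scalemxAl -!scalemxAr.
have E1 (P Q : 'M[R]_1) : (P + Q) 0 0 = P 0 0 + Q 0 0 by rewrite mxE.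
have E2 (s : R) (P : 'M[R]_1) : (s *: P) 0 0 = s * P 0 0 by rewrite mxE.
rewrite !(E1, E2).
by rewrite -!/(bf B _ _) bfC; ring.
Qed.

Let bf_deltal B i v : bf B (delta_mx 0 i) v = \sum_j B i j * v 0 j.
Proof. by rewrite /bf -rowE mxE; apply: eq_bigr => j _; rewrite !mxE. Qed.

Let bf_delta B i j : bf B (delta_mx 0 i) (delta_mx 0 j) = B i j.
Proof.
rewrite bf_deltal (bigD1 j)//= big1 ?addr0 => [|k /negbTE kj]; rewrite !mxE eqxx.
  by rewrite eqxx mulr1.
by rewrite kj mulr0.
Qed.

Lemma psd_diag_ge0 B i : pos_semidef B -> 0 <= B i i.
Proof. by move=> /(_ (delta_mx 0 i)); rewrite -/(bf _ _ _) bf_delta. Qed.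

(** Otherwise the form would take the value [-1] at a suitable combination of the
    basis vectors [i] and [j]. *)
Lemma psd_diag0 B i j : B^T = B -> pos_semidef B -> B i i = 0 -> B i j = 0.
Proof.
move=> symB psdB Bii; apply/eqP/negPn/negP => Bij.
have := psdB (delta_mx 0 j + (- (B j j + 1) / (2 * B i j)) *: delta_mx 0 i).
rewrite -/(bf _ _ _) bf_line// !bf_delta Bii mulr0 addr0.
have -> : B j j + 2 * (- (B j j + 1) / (2 * B i j)) * B i j = - 1 by field.
by rewrite ler0N1.
Qed.

(** Subtracting from [B] the rank-one matrices [(row p B)^T *m row p B / B p p]
    one after the other writes it as a sum of squares, which reduces the sum to
    values of the quadratic form of [H]. The induction is on the number of
    nonzero diagonal entries. *)
Lemma psd_trace_le0 B H : B^T = B -> pos_semidef B ->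
  (forall v : 'rV[R]_N, \sum_i \sum_j v 0 i * v 0 j * H i j <= 0) ->
  \sum_i \sum_j B i j * H i j <= 0.
Proof.
move=> symB psdB HH.
move: {2}#|_| (leqnn #|[pred i | B i i != 0%R]|) => n.
elim: n B symB psdB => [|n IH] B symB psdB cB.
  rewrite big1// => i _; rewrite big1// => j _.
  rewrite (@psd_diag0 B i j)// ?mul0r//; apply/eqP/negPn/negP => Bi.
  by move: cB; rewrite leqn0 => /eqP/card0_eq/(_ i); rewrite !inE Bi.
case: (pickP [pred i | B i i != 0]) => [p /= Bp|B0]; last first.
  by apply: IH => //; rewrite eq_card0.
have Bpp : 0 < B p p by rewrite lt_neqAle eq_sym Bp psd_diag_ge0.
pose B' := \matrix_(i, j) (B i j - B p i * B p j / B p p).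
have Bji i j : B j i = B i j by rewrite -[in LHS]symB mxE.
have symB' : B'^T = B' by apply/matrixP => i j; rewrite !mxE Bji [B p j * _]mulrC.
have psdB' : pos_semidef B'.
  move=> v; rewrite -/(bf _ _ _).
  pose s := bf B (delta_mx 0 p) v.
  have := psdB (v + (- s / B p p) *: delta_mx 0 p); rewrite -/(bf _ _ _) bf_line//.
  rewrite bf_delta -/s.
  suff -> : bf B' v v = bf B v v - s ^+ 2 / B p p.
    by congr (0 <= _); field.
  rewrite !bfE /s bf_deltal expr2 mulr_suml mulr_suml -sumrB; apply: eq_bigr => i _.
  rewrite mulr_sumr mulr_suml -sumrB; apply: eq_bigr => j _.
  by rewrite !mxE; field.
have cB' : (#|[pred i | B' i i != 0%R]| <= n)%N.
  rewrite -ltnS; apply: leq_trans cB; apply: proper_card.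
  apply/properP; split; last first.
    by exists p; rewrite !inE// negbK !mxE mulfK// subrr.
  apply/fintype.subsetP => i; rewrite !inE; apply: contra => /eqP Bi.
  by rewrite !mxE Bi (Bji i p) (@psd_diag0 B i p)// !mul0r subr0.
have -> : \sum_i \sum_j B i j * H i j = \sum_i \sum_j B' i j * H i j +
    (B p p)^-1 * \sum_i \sum_j (row p B) 0 i * (row p B) 0 j * H i j.
  rewrite mulr_sumr -big_split /=; apply: eq_bigr => i _.
  rewrite mulr_sumr -big_split /=; apply: eq_bigr => j _.
  by rewrite !mxE; field.
rewrite -[X in _ <= X]addr0 lerD//; first exact: IH.
by rewrite mulr_ge0_le0// invr_ge0 ltW.
Qed.

End trace.

(** * Operators in divergence form *)

Definition opDiv {R : realType} {N} (b : 'rV[R]_N -> 'M[R]_N)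
    (f : 'rV[R]_N -> R) : 'rV[R]_N -> R :=
  fun x => \sum_i \sum_j partial i (fun y => b y i j * partial j f y) x.

Lemma opDivE {R : realType} {N k} {U : set 'rV[R]_N} {b : 'rV[R]_N -> 'M[R]_N}
    {f} : open U -> (forall i j, is_smooth setT (fun x => b x i j)) ->
  is_Ck k.+2 U f -> forall x, U x ->
  opDiv b f x = \sum_i \sum_j (b x i j * partial i (partial j f) x +
    partial j f x * partial i (fun y => b y i j) x).
Proof.
move=> oU Hb Hf x Ux; apply: eq_bigr => i _; apply: eq_bigr => j _.
have [_ E] := is_deriveM (is_Ck_is_derive (Hb i j 1%N) i x I)
  (is_Ck_is_derive (is_Ck_partial Hf j) i x Ux).
exact: E.
Qed.

(** At a maximum the first-order terms vanish, and what remains is the trace of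
    the product of [b y] with the Hessian. *)
Lemma opDiv_le0_at_max {R : realType} {N k} {U : set 'rV[R]_N}
    {b : 'rV[R]_N -> 'M[R]_N} {f y} : open U ->
  (forall i j, is_smooth setT (fun x => b x i j)) ->
  (b y)^T = b y -> pos_semidef (b y) ->
  is_Ck k.+2 U f -> max_at U f y -> opDiv b f y <= 0.
Proof.
move=> oU Hb bsym bpsd Hf fM; rewrite (opDivE oU Hb Hf y (proj1 fM)).
rewrite (eq_bigr (fun i => \sum_j b y i j *
    (\matrix_(i, j) partial i (partial j f) y) i j)).
  apply: psd_trace_le0 => // v; apply: le_trans (hessian_le0_at_max oU Hf fM v).
  by rewrite le_eqVlt; apply/orP; left; apply/eqP; do 2 (apply: eq_bigr => ? _);
    rewrite mxE.
move=> i _; apply: eq_bigr => j _; rewrite mxE.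
by rewrite (partial_eq0_at_max oU (is_CkW (leqnSn _) Hf) fM) mul0r addr0.
Qed.

Lemma opDiv_lin {R : realType} {N} {U : set 'rV[R]_N} {b : 'rV[R]_N -> 'M[R]_N}
    {f g} a : open U -> (forall i j, is_smooth setT (fun x => b x i j)) ->
  is_Ck 2 U f -> is_Ck 2 U g -> forall x, U x ->
  opDiv b (fun x => a * f x + g x) x = a * opDiv b f x + opDiv b g x.
Proof.
move=> oU Hb Hf Hg x Ux.
have dl k (f' g' : 'rV[R]_N -> R) i z : is_Ck k.+1 U f' -> is_Ck k.+1 U g' -> U z ->
    partial i (fun y => a * f' y + g' y) z = a * partial i f' z + partial i g' z.
  move=> Hf' Hg' Uz.
  have d1 := is_Ck_is_derive Hf' i z Uz; have d2 := is_Ck_is_derive Hg' i z Uz.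
  by have [_ E] := is_deriveD (is_deriveZ a d1) d2; exact: E.
have fg : is_Ck 2 U (fun x => a * f x + g x) := is_CkD oU (is_CkZ a oU Hf) Hg.
rewrite (opDivE oU Hb fg x Ux) (opDivE oU Hb Hf x Ux) (opDivE oU Hb Hg x Ux).
rewrite mulr_sumr -big_split; apply: eq_bigr => i _.
rewrite mulr_sumr -big_split; apply: eq_bigr => j _ /=.
have E : {in U, partial j (fun y => a * f y + g y) =1
    fun y => a * partial j f y + partial j g y}.
  by move=> z; rewrite inE => Uz; exact: dl Hf Hg Uz.
have -> : partial i (partial j (fun y => a * f y + g y)) x =
    a * partial i (partial j f) x + partial i (partial j g) x.
  rewrite (partial_eq_on i oU E) ?inE; last exact: Ux.
  exact: dl (is_Ck_partial Hf j) (is_Ck_partial Hg j) Ux.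
have -> : partial j (fun y => a * f y + g y) x = a * partial j f x + partial j g x.
  exact: dl Hf Hg Ux.
have alg (c P Q p q d : R) :
  c * (a * P + Q) + (a * p + q) * d = a * (c * P + p * d) + (c * Q + q * d) by ring.
exact: alg.
Qed.

Lemma is_Ck_opDiv {R : realType} {N k} {U : set 'rV[R]_N}
    {b : 'rV[R]_N -> 'M[R]_N} {f} : open U ->
  (forall i j, is_smooth setT (fun x => b x i j)) ->
  is_Ck k.+2 U f -> is_Ck k U (opDiv b f).
Proof.
move=> oU Hb Hf; apply: (is_Ck_sum _ _ oU) => i; apply: (is_Ck_sum _ _ oU) => j.
apply: is_Ck_partial; apply: (is_CkM oU _ (is_Ck_partial Hf j)).
exact: is_Ck_sub (@subsetT _ U) (Hb i j k.+1).
Qed.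

Lemma opDiv_cst {R : realType} {N} (b : 'rV[R]_N -> 'M[R]_N) (a : R) x :
  opDiv b (fun=> a) x = 0.
Proof.
have E i j : (fun z => b z i j * partial j (fun=> a) z) = fun=> 0.
  by apply/funext => z; rewrite /partial derive_cst mulr0.
rewrite /opDiv big1 => // i _.
by rewrite big1// => j _; rewrite E /partial derive_cst.
Qed.

Lemma opDiv_eq_on {R : realType} {N} {U : set 'rV[R]_N} (b : 'rV[R]_N -> 'M[R]_N)
    {f g} : open U -> {in U, f =1 g} -> {in U, opDiv b f =1 opDiv b g}.
Proof.
move=> oU fg x Ux; apply: eq_bigr => i _; apply: eq_bigr => j _.
have E : {in U, (fun y => b y i j * partial j f y) =1
    fun y => b y i j * partial j g y}.
  by move=> z Uz; rewrite (partial_eq_on j oU fg z Uz).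
exact: (partial_eq_on i oU E).
Qed.

(** A nonzero positive semi-definite matrix has a positive diagonal entry
    [b y k k]; then [(x_k - y_k)^2], on which [opDiv b] takes the value
    [2 b y k k] at [y], is a strict subsolution near [y]. *)
Lemma barrier {R : realType} {N} (b : 'rV[R]_N -> 'M[R]_N) (y : 'rV[R]_N)
    (P : set 'rV[R]_N) :
  (forall i j, is_smooth setT (fun x => b x i j)) -> (b y)^T = b y ->
  pos_semidef (b y) -> b y != 0 -> nbhs y P ->
  exists (r : R) (psi : 'rV[R]_N -> R) (C : R), [/\ 0 < r,
    forall x, `|x - y| <= r -> P x, is_smooth setT psi & [/\
    forall x, `|x - y| <= r -> 1 <= opDiv b psi x,
    forall x, 0 <= psi x & forall x, `|x - y| <= r -> psi x <= C]].
Proof.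
move=> Hb bsym bpsd b0 yP.
have [k bk] : exists k, 0 < b y k k.
  apply: contrapT => /forallNP H; move/negP: b0; apply; apply/eqP/matrixP => i j.
  rewrite mxE; apply: psd_diag0 => //; apply/eqP; rewrite eq_le psd_diag_ge0// andbT.
  by rewrite leNgt; apply/negP; exact: H.
pose q (x : 'rV[R]_N) := x 0 k - y 0 k; pose psi0 x := q x * q x.
have dq (i : 'I_N) (x : 'rV[R]_N) : is_derive x (delta_mx 0 i) q (i == k)%:R.
  have := is_deriveB (is_derive_coord i k x) (is_derive_cst (y 0 k) x (delta_mx 0 i)).
  by rewrite subr0.
have qS n : is_Ck n setT q := is_CkB openT (is_Ck_coord k openT) (is_Ck_cst _ openT).
have psi0S n : is_Ck n setT psi0 := is_CkM openT (qS n) (qS n).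
have dpsi0 j : partial j psi0 = fun x => (2 * (j == k)%:R) * q x.
  apply/funext => x; have [_ E] := is_deriveM (dq j x) (dq j x).
  by rewrite [LHS]E -![_ *: _]/(_ * _) mulrC -mulrDl mulr_natl -mulr2n mulrC.
have ddpsi0 i j x : partial i (partial j psi0) x = (2 * (j == k)%:R) * (i == k)%:R.
  by rewrite dpsi0; have [_ E] := is_deriveZ (2 * (j == k)%:R) (dq i x); exact: E.
have q0 : q y = 0 by rewrite /q subrr.
have Ly : opDiv b psi0 y = 2 * b y k k.
  rewrite (opDivE openT Hb (psi0S 2%N) y I) (bigD1 k)//= [X in _ + X]big1 => [|i ik].
    rewrite (bigD1 k)//= big1 => [|j jk].
      by rewrite ddpsi0 dpsi0 q0 eqxx !mulr1 mulr0 mul0r !addr0 mulrC.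
    by rewrite ddpsi0 dpsi0 q0 (negbTE jk) mulr0 !mul0r mulr0 addr0.
  rewrite big1// => j _.
  by rewrite ddpsi0 dpsi0 q0 (negbTE ik) !mulr0 mul0r addr0.
have cL : {for y, continuous (opDiv b psi0)}.
  exact: is_Ck_cont (is_Ck_opDiv openT Hb (psi0S 2%N)) y I.
have : \forall x \near y, P x /\ b y k k < opDiv b psi0 x.
  near=> x; split; first by near: x.
  near: x; apply: (cvgr_gt _ cL); rewrite Ly.
  by rewrite mulr_natl mulr2n ltrDl.
move=> /nbhs_ballP[d /= d0 Hd].
have d20 : 0 < d / 2 by rewrite divr_gt0.
have Bd x : `|x - y| <= d / 2 -> P x /\ b y k k < opDiv b psi0 x.
  move=> xy; apply: Hd; rewrite -ball_normE /= distrC; apply: le_lt_trans xy _.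
  by rewrite ltr_pdivrMr// ltr_pMr// ltr1n.
pose c := (b y k k)^-1; have c0 : 0 < c by rewrite invr_gt0.
exists (d / 2), (fun x => c * psi0 x + 0), (c * (d / 2 * (d / 2))); split.
- exact: d20.
- by move=> x /Bd[].
- by move=> n; exact: is_CkD openT (is_CkZ c openT (psi0S n)) (is_Ck_cst 0 openT).
split.
- move=> x /Bd[_ H].
  rewrite (opDiv_lin c openT Hb (psi0S 2%N) (is_Ck_cst 0 openT) x I) opDiv_cst addr0.
  by rewrite mulrC ler_pdivlMr// mul1r ltW.
- by move=> x; rewrite addr0 mulr_ge0 ?(ltW c0)// /psi0 -expr2 sqr_ge0.
- move=> x /rV_normP-/(_ (ltW d20))/(_ k); rewrite !mxE => xy.
  rewrite addr0 ler_pM2l// /psi0 -!expr2 -[q x ^+ 2]real_normK ?num_real//.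
  by rewrite ler_pXn2r// ?nnegrE// ltW.
Unshelve. all: by end_near. Qed.

(** * Integrals of continuous functions with compact support *)

Definition cont_supp {R : realType} {V : normedModType R} (r : R) (f : V -> R) :=
  continuous f /\ forall x, r <= `|x| -> f x = 0.

Lemma cont_suppW {R : realType} {V : normedModType R} {r s : R} {f : V -> R} :
  r <= s -> cont_supp r f -> cont_supp s f.
Proof. by move=> rs [cf f0]; split=> // x /(le_trans rs); exact: f0. Qed.

Lemma cont_supp_lin {R : realType} {V : normedModType R} {r : R} {f g : V -> R} a :
  cont_supp r f -> cont_supp r g -> cont_supp r (fun x => a * f x + g x).
Proof.
move=> [cf f0] [cg g0]; split=> [x|x rx]; last by rewrite f0// g0// mulr0 addr0.
by apply: continuousD (cg x); apply: continuousM (cf x); exact: cst_continuous.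
Qed.

Lemma cont_supp0 {R : realType} {V : normedModType R} {r : R} :
  cont_supp r (fun _ : V => 0 : R).
Proof. by split=> [x|//]; exact: cst_continuous. Qed.

Section line_integral.
Context {R : realType}.
Notation mu := (@lebesgue_measure R).
Implicit Types (g : R -> R) (r : R).

Let restrictE {g r} : cont_supp r g -> g = g \_ `[- r, r].
Proof.
move=> [_ g0]; apply/funext => t; rewrite patchE; case: ifPn => //.
rewrite notin_setE /= in_itv/= -ler_norml => /negP; rewrite -ltNge => rt.
by rewrite g0// ltW.
Qed.

Lemma cont_supp_integrable {r g} : cont_supp r g -> mu.-integrable setT (EFin \o g).
Proof.
move=> Hg; rewrite [X in _ _ X](_ : _ = (EFin \o g) \_ `[- r, r]).
  apply/(integrable_mkcond _ _).1 => //.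
  apply: continuous_compact_integrable; first exact: segment_compact.
  by apply: continuous_subspaceT; exact: Hg.1.
by rewrite [in LHS](restrictE Hg) restrict_EFin.
Qed.

Lemma cont_supp_RintegralE {r g} : cont_supp r g ->
  \int[mu]_t g t = \int[mu]_(t in `[- r, r]) g t.
Proof. by move=> Hg; rewrite [RHS]Rintegral_mkcond -(restrictE Hg). Qed.

Lemma cont_supp_Rintegral_le {r g} (e : R) : 0 < r -> cont_supp r g ->
  (forall t, `|g t| <= e) -> `|\int[mu]_t g t| <= e * (2 * r).
Proof.
move=> r0 Hg ge; rewrite (cont_supp_RintegralE Hg).
have mI : measurable (`[- r, r]%classic : set R) by exact: measurable_itv.
have ig : mu.-integrable `[- r, r] (EFin \o g).
  apply: continuous_compact_integrable; first exact: segment_compact.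
  by apply: continuous_subspaceT; exact: Hg.1.
apply: (@le_trans _ _ (\int[mu]_(t in `[- r, r]) `|g t|)).
  exact: le_normr_Rintegral.
have -> : e * (2 * r) = \int[mu]_(t in `[- r, r]) e.
  rewrite Rintegral_cst//= lebesgue_measure_itv/= lte_fin.
  by rewrite ifT /=; [congr (_ * _); ring|lra].
apply: le_Rintegral => //.
- apply: continuous_compact_integrable; first exact: segment_compact.
  apply: continuous_subspaceT => t.
  by apply: (continuous_comp (Hg.1 t)); exact: norm_continuous.
- apply: continuous_compact_integrable; first exact: segment_compact.
  by apply: continuous_subspaceT => t; exact: cst_continuous.
Qed.

Lemma cont_supp_Rintegral_lin {r g1 g2} a : cont_supp r g1 -> cont_supp r g2 ->
  \int[mu]_t (a * g1 t + g2 t) = a * (\int[mu]_t g1 t) + \int[mu]_t g2 t.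
Proof.
move=> H1 H2; have i1 := cont_supp_integrable H1; have i2 := cont_supp_integrable H2.
rewrite RintegralD//; last first.
  have := cont_supp_integrable (cont_supp_lin a H1 cont_supp0).
  by congr (integrable _ _ _); apply/funext => t /=; rewrite addr0.
by rewrite RintegralZl.
Qed.

Lemma cont_supp_Rintegral_gt0 {r g} t0 : cont_supp r g -> (forall t, 0 <= g t) ->
  0 < g t0 -> 0 < \int[mu]_t g t.
Proof.
move=> Hg g0 gt0.
have /nbhs_ballP[d /= d0 Hd] : \forall t \near t0, g t0 / 2 < g t.
  by apply: (cvgr_gt _ (Hg.1 t0)); rewrite ltr_pdivrMr// ltr_pMr// ltr1n.
pose I := (`[t0 - d / 2, t0 + d / 2]%classic : set R).
have mI : measurable I by exact: measurable_itv.
apply: (@lt_le_trans _ _ (\int[mu]_(t in I) (g t0 / 2))).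
  rewrite Rintegral_cst//= /I lebesgue_measure_itv/= lte_fin ifT /=; last by lra.
  by rewrite mulr_gt0 ?divr_gt0//; lra.
have ic : mu.-integrable I (EFin \o (fun=> g t0 / 2)).
  apply: continuous_compact_integrable; first exact: segment_compact.
  by apply: continuous_subspaceT => t; exact: cst_continuous.
rewrite Rintegral_mkcond; apply: le_Rintegral => //.
- by rewrite -restrict_EFin; apply/(integrable_mkcond _ _).1.
- exact: cont_supp_integrable Hg.
- move=> t _; rewrite patchE; case: ifPn => [|_ //].
  rewrite inE /I /= in_itv/= => tI; apply/ltW/Hd.
  by rewrite -ball_normE /ball_ /= ltr_norml; lra.
Qed.

Lemma cont_supp_Rintegral_derive {r} {G g : R -> R} : 0 < r ->
  cont_supp r G -> cont_supp r g ->
  (forall t : R, is_derive t 1 G (g t)) -> \int[mu]_t g t = 0.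
Proof.
move=> r0 HG Hg dG; rewrite (cont_supp_RintegralE Hg) /Rintegral.
rewrite (@continuous_FTC2 _ g G)//.
- have -> : G r = 0 by apply: HG.2; exact: ler_norm.
  have -> : G (- r) = 0 by apply: HG.2; rewrite normrN; exact: ler_norm.
  by rewrite -EFinB subrr.
- by lra.
- by apply: continuous_subspaceT; exact: Hg.1.
- split=> [t _||]; first by case: (dG t).
  + exact/cvg_at_right_filter/HG.1.
  + exact/cvg_at_left_filter/HG.1.
- by move=> t _; rewrite derive1E; case: (dG t).
Qed.

End line_integral.

(** The uniform modulus comes from the compactness of the closed ball of radius
    [r + 1]; farther away both values are 0. *)
Lemma cont_supp_unif {R : realType} {n} {r : R} {f : 'rV[R]_n -> R} (e : R) :
  cont_supp r f -> 0 < e ->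
  exists2 d : R, 0 < d & forall x y, `|x - y| < d -> `|f x - f y| <= e.
Proof.
move=> [cf f0] e0.
pose K : set 'rV[R]_n := [set x | `|x| <= r + 1].
have cK : compact K.
  have -> : K = [set x | `|x - 0| <= r + 1].
    by apply/funext => x; rewrite /= subr0.
  exact: cube_compact.
pose P (d : R) (x : 'rV[R]_n) := forall y, `|x - y| < d -> `|f x - f y| <= e.
have : \forall d \near 0^'+, K `<=` P d.
  apply: (compact_near_coveringP K).1 => // x _.
  have /nbhs_ballP[d /= d0 Hd] : \forall z \near x, `|f x - f z| <= e / 2.
    by move/cvgrPdist_le : (cf x) => /(_ (e / 2)); apply; rewrite divr_gt0.
  near=> x' d' => y /= xy.
  have xx' : ball x (d / 2) x'.
    by near: x'; apply/nbhs_ballP; exists (d / 2) => //=; rewrite divr_gt0.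
  have d'd : d' < d / 2 by near: d'; apply: nbhs_right_lt; rewrite divr_gt0.
  have x'b : ball x d x'.
    by apply: le_ball xx'; rewrite ler_pdivrMr// ler_pMr// ler1n.
  have yb : ball x d y.
    move: xx'; rewrite -!ball_normE /ball_ /= => xx'.
    rewrite -[x - y](subrKA x') [d]splitr.
    by apply: le_lt_trans (ler_normD _ _) _; apply: ltrD => //; exact: lt_trans d'd.
  rewrite -(subrKA (f x)) [e]splitr.
  apply: le_trans (ler_normD _ _) _; apply: lerD; last exact: Hd.
  by rewrite distrC; exact: Hd.
move=> H; near (0 : R)^'+ => d.
have Hd : K `<=` P d by near: d.
have d0 : 0 < d by near: d; exact: nbhs_right_gt.
have d1 : d < 1 by near: d; exact: nbhs_right_lt.
exists d => // x y xy.
have [xr|xr] := leP `|x| (r + 1); first exact: Hd.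
have xyr : `|x| <= `|x - y| + `|y| by rewrite -{1}(subrK y x) ler_normD.
by rewrite !f0 ?subrr ?normr0 ?(ltW e0)//; move: xr xy d1 xyr; lra.
Unshelve. all: by end_near. Qed.

Definition slice {R : realType} {n} (f : 'rV[R]_n.+1 -> R) (t : R) : 'rV[R]_n -> R :=
  fun y => f (row_mx (const_mx t : 'rV[R]_1) y).

Lemma row_mx_norm {R : realType} {n} (t : R) (y : 'rV[R]_n) :
  `|row_mx (const_mx t : 'rV[R]_1) y : 'rV[R]_n.+1| = Num.max `|t| `|y|.
Proof.
pose z : 'rV[R]_n.+1 := row_mx (const_mx t : 'rV[R]_1) y; rewrite -/z.
have zl (j : 'I_1) : z 0 (lshift n j) = t.
  by apply: (etrans (row_mxEl (const_mx t : 'rV[R]_1) y 0 j)); rewrite mxE.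
have zr (j : 'I_n) : z 0 (rshift 1 j) = y 0 j by exact: row_mxEr.
have m0 : 0 <= Num.max `|t| `|y| by rewrite le_max normr_ge0.
apply/eqP; rewrite eq_le; apply/andP; split.
  apply/(rV_normP _ _ m0) => i; case: (split_ordP (i : 'I_(1 + n))) => j ->.
    by rewrite zl le_max lexx.
  by rewrite zr le_max ((rV_normP y _ (normr_ge0 y)).1 (lexx _)) orbT.
have H := (rV_normP z _ (normr_ge0 z)).1 (lexx _).
rewrite ge_max; apply/andP; split; first by rewrite -(zl 0).
by apply/(rV_normP y _ (normr_ge0 _)) => j; rewrite -zr.
Qed.

Lemma row_mx_sub {R : realType} {n} (t s : R) (y z : 'rV[R]_n) :
  row_mx (const_mx t : 'rV[R]_1) y - row_mx (const_mx s) z =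
  row_mx (const_mx (t - s)) (y - z).
Proof.
rewrite opp_row_mx add_row_mx; congr row_mx.
by apply/rowP => i; rewrite !mxE.
Qed.

Lemma row_mx_continuous {R : realType} {n} (t : R) :
  continuous (fun y : 'rV[R]_n => row_mx (const_mx t : 'rV[R]_1) y : 'rV[R]_n.+1).
Proof.
move=> y A /nbhs_ballP[e e0 HA]; apply/nbhs_ballP; exists e => // z.
rewrite -ball_normE /= => yz; apply: HA; rewrite -ball_normE /=.
have := row_mx_sub t t y z; rewrite /= => ->.
by rewrite row_mx_norm subrr normr0 gt_max e0.
Qed.

Lemma slice_supp {R : realType} {n} {r : R} {f : 'rV[R]_n.+1 -> R} t :
  cont_supp r f -> cont_supp r (slice f t).
Proof.
move=> [cf f0]; split=> [y|y ry].
  by apply: continuous_comp; [exact: row_mx_continuous|exact: cf].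
by apply: f0; rewrite row_mx_norm le_max ry orbT.
Qed.

Lemma slice_eq0 {R : realType} {n} {r : R} {f : 'rV[R]_n.+1 -> R} t :
  cont_supp r f -> r <= `|t| -> slice f t = fun=> 0.
Proof.
by move=> [_ f0] rt; apply/funext => y; apply: f0; rewrite row_mx_norm le_max rt.
Qed.

Lemma integral_rVS {R : realType} {n} (f : 'rV[R]_n.+1 -> R) :
  integral_rV f = \int[@lebesgue_measure R]_t integral_rV (slice f t).
Proof. by []. Qed.

Lemma integral_rV_ge0 {R : realType} {n} (f : 'rV[R]_n -> R) :
  (forall x, 0 <= f x) -> 0 <= integral_rV f.
Proof.
elim: n f => [|n IH] f f0 /=; first exact: f0.
by apply: Rintegral_ge0 => t _; apply: IH => y; exact: f0.
Qed.

(** The bound and the linearity in dimension [n] give the continuity of the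
    integral of the slices of a function of [n.+1] variables, which in turn
    gives them in dimension [n.+1]: hence the two hypotheses here, and the joint
    induction below. *)
Lemma integral_slice_supp_step {R : realType} {n} {r : R} : 0 < r ->
  (forall (f : 'rV[R]_n -> R) (e : R), cont_supp r f -> (forall x, `|f x| <= e) ->
     `|integral_rV f| <= e * (2 * r) ^+ n) ->
  (forall (f g : 'rV[R]_n -> R) a, cont_supp r f -> cont_supp r g ->
     integral_rV (fun x => a * f x + g x) = a * integral_rV f + integral_rV g) ->
  forall f : 'rV[R]_n.+1 -> R, cont_supp r f ->
  cont_supp r (fun t => integral_rV (slice f t)).
Proof.
move=> r0 bound lin f Hf; have r20 : 0 < (2 * r) ^+ n by rewrite exprn_gt0// mulr_gt0.
split=> [t|t rt]; last first.
  rewrite (slice_eq0 t Hf rt); apply/eqP.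
  rewrite -normr_le0 -[X in _ <= X](mul0r ((2 * r) ^+ n)).
  by apply: (bound _ 0 cont_supp0) => x; rewrite normr0.
apply/cvgrPdist_le => e e0.
have [|d d0 Hd] := cont_supp_unif (e / (2 * r) ^+ n) Hf; first by rewrite divr_gt0.
near=> s.
have -> : integral_rV (slice f t) - integral_rV (slice f s) =
    integral_rV (fun y => -1 * slice f s y + slice f t y).
  by rewrite (lin _ _ _ (slice_supp s Hf) (slice_supp t Hf)) mulN1r addrC.
rewrite -(divfK (lt0r_neq0 r20) e); apply: bound.
  by apply: cont_supp_lin; exact: slice_supp.
move=> y; rewrite mulN1r addrC; apply: Hd.
rewrite row_mx_sub row_mx_norm subrr normr0 gt_max d0 andbT.
by near: s; apply: cvgr_dist_lt.
Unshelve. all: by end_near. Qed.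

Lemma integral_rV_bound_lin {R : realType} {n} {r : R} : 0 < r ->
  (forall (f : 'rV[R]_n -> R) (e : R), cont_supp r f -> (forall x, `|f x| <= e) ->
     `|integral_rV f| <= e * (2 * r) ^+ n) /\
  (forall (f g : 'rV[R]_n -> R) a, cont_supp r f -> cont_supp r g ->
     integral_rV (fun x => a * f x + g x) = a * integral_rV f + integral_rV g).
Proof.
move=> r0; elim: n => [|n [IHb IHl]].
  by split=> [f e _ fe|//]; rewrite expr0 mulr1; exact: fe.
have supp := integral_slice_supp_step r0 IHb IHl.
split=> [f e Hf fe|f g a Hf Hg].
  rewrite integral_rVS exprS mulrA mulrAC; apply: cont_supp_Rintegral_le => //.
    exact: supp.
  by move=> t; apply: IHb (slice_supp t Hf) _ => y; exact: fe.
rewrite !integral_rVS -(cont_supp_Rintegral_lin a (supp f Hf) (supp g Hg)).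
apply: eq_Rintegral => t _.
exact: IHl (slice_supp t Hf) (slice_supp t Hg).
Qed.

Section integral_rV_theory.
Context {R : realType}.

Lemma integral_rV_bound {n} {r : R} {f : 'rV[R]_n -> R} (e : R) : 0 < r ->
  cont_supp r f -> (forall x, `|f x| <= e) ->
  `|integral_rV f| <= e * (2 * r) ^+ n.
Proof. by move=> r0; exact: (integral_rV_bound_lin r0).1. Qed.

Lemma integral_rV_lin {n} {r : R} {f g : 'rV[R]_n -> R} a : 0 < r ->
  cont_supp r f -> cont_supp r g ->
  integral_rV (fun x => a * f x + g x) = a * integral_rV f + integral_rV g.
Proof. by move=> r0; exact: (integral_rV_bound_lin r0).2. Qed.

Lemma integral_rV_cst0 {n} : integral_rV (fun _ : 'rV[R]_n => 0 : R) = 0.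
Proof.
apply/eqP; rewrite -normr_le0 -[X in _ <= X](mul0r ((2 * 1) ^+ n)).
by apply: (integral_rV_bound 0 ltr01 cont_supp0) => x; rewrite normr0.
Qed.

Lemma integral_slice_supp {n} {r : R} {f : 'rV[R]_n.+1 -> R} : 0 < r ->
  cont_supp r f -> cont_supp r (fun t => integral_rV (slice f t)).
Proof.
move=> r0; apply: (integral_slice_supp_step r0) => [g e|g1 g2 a].
  exact: integral_rV_bound.
exact: integral_rV_lin.
Qed.

Lemma integral_rV_gt0 {n} {r : R} {f : 'rV[R]_n -> R} x0 : 0 < r ->
  cont_supp r f -> (forall x, 0 <= f x) -> 0 < f x0 -> 0 < integral_rV f.
Proof.
move=> r0; elim: n f x0 => [|n IH] f x0 Hf f0 fx0 /=.
  by rewrite [X in f X](_ : _ = x0)//; apply/rowP => -[].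
apply: (cont_supp_Rintegral_gt0 (x0 0 0) (integral_slice_supp r0 Hf)).
  by move=> t; apply: integral_rV_ge0 => y; exact: f0.
apply: (IH _ (rsubmx (x0 : 'rV[R]_(1 + n))) (slice_supp _ Hf)).
  by move=> y; exact: f0.
rewrite /slice; set z := (X in f X); suff -> : z = x0 by [].
apply/rowP => i; rewrite mxE; case: (split_ordP (i : 'I_(1 + n))) => j ->.
  by rewrite mxE; congr (x0 0 _); apply/val_inj; rewrite /= ord1.
by rewrite mxE.
Qed.

(** Differentiation under the integral sign: difference quotients of [F] in the
    first variable converge uniformly, by the mean value theorem and the uniform
    continuity of the derivative. *)
Lemma is_derive_integral_slice {n} {r : R} {F dF : 'rV[R]_n.+1 -> R} : 0 < r ->
  cont_supp r F -> cont_supp r dF ->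
  (forall x, is_derive x (delta_mx 0 0) F (dF x)) ->
  forall t : R, is_derive t 1 (fun t => integral_rV (slice F t))
    (integral_rV (slice dF t)).
Proof.
move=> r0 HF HdF dFF t.
have r20 : 0 < (2 * r) ^+ n by rewrite exprn_gt0// mulr_gt0.
suff H : (fun h : R => h^-1 *: (((fun t => integral_rV (slice F t)) \o shift t)
    (h *: 1) - integral_rV (slice F t))) @ 0^' --> integral_rV (slice dF t).
  by apply: DeriveDef; [apply/cvg_ex; eexists; exact: H|exact: cvg_lim H].
apply/cvgrPdist_le => e e0.
have [|d d0 Hd] := cont_supp_unif (e / (2 * r) ^+ n) HdF; first by rewrite divr_gt0.
near=> h.
have h0 : h != 0 by near: h; exact: nbhs_dnbhs_neq.
have hd : `|h| < d.
  near: h; apply: nbhs_dnbhs; exists d => //= z.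
  by rewrite /ball_ /= sub0r normrN.
rewrite /= [h *: 1]mulr1 -[_ *: _]/(_ * _) distrC.
have H0 := cont_supp_lin (-1) (slice_supp t HdF)
    (cont_supp_lin h^-1 (slice_supp (h + t) HF)
      (cont_supp_lin (- h^-1) (slice_supp t HF)
        (cont_supp_lin (-1) (slice_supp t HF) (slice_supp t HF)))).
have -> : h^-1 * (integral_rV (slice F (h + t)) - integral_rV (slice F t)) -
    integral_rV (slice dF t) =
    integral_rV (fun y => -1 * slice dF t y + (h^-1 * slice F (h + t) y +
      (- h^-1 * slice F t y + (-1 * slice F t y + slice F t y)))).
  have I2 := slice_supp t HF; have I1 := slice_supp (h + t) HF.
  have I3 := cont_supp_lin (-1) I2 I2.
  have I4 := cont_supp_lin (- h^-1) I2 I3.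
  have I5 := cont_supp_lin h^-1 I1 I4.
  rewrite (integral_rV_lin _ r0 (slice_supp t HdF) I5).
  rewrite (integral_rV_lin _ r0 I1 I4) (integral_rV_lin _ r0 I2 I3).
  rewrite (integral_rV_lin _ r0 I2 I2); ring.
rewrite -(divfK (lt0r_neq0 r20) e); apply: (integral_rV_bound _ r0) => // y.
pose x : 'rV[R]_n.+1 := row_mx (const_mx t : 'rV[R]_1) y.
have shiftE (s : R) : x + s *: delta_mx 0 0 = row_mx (const_mx (s + t) : 'rV[R]_1) y.
  apply/rowP => i; rewrite !mxE; case: (split_ordP (i : 'I_(1 + n))) => j ->.
    by rewrite !mxE (ord1 j) !eqxx /= mulr1 addrC.
  by rewrite eqxx (_ : (rshift 1 j == 0) = false)// mulr0 addr0.
have [|c ch E] := @MVT_symmetric R (fun s : R => F (x + s *: delta_mx 0 0))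
    (fun s : R => dF (x + s *: delta_mx 0 0)) h.
  by move=> s _; exact: is_derive_line (dFF _).
have -> : -1 * slice dF t y + (h^-1 * slice F (h + t) y +
    (- h^-1 * slice F t y + (-1 * slice F t y + slice F t y))) =
    dF (x + c *: delta_mx 0 0) - dF x.
  have := E; rewrite scale0r addr0 shiftE => E'.
  have -> : dF (x + c *: delta_mx 0 0) = h^-1 * (slice F (h + t) y - slice F t y).
    by rewrite /slice -/x E' mulrCA mulVf// mulr1.
  have -> : dF x = slice dF t y by [].
  ring.
apply: Hd; rewrite addrAC subrr add0r normrZ.
apply: le_lt_trans hd; apply: le_trans ch.
rewrite -[X in _ <= X]mulr1 ler_wpM2l//; apply/(rV_normP _ _ ler01) => i.
by rewrite !mxE; case: (_ && _); rewrite ?normr1 ?normr0.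
Unshelve. all: by end_near. Qed.

Lemma slice_is_Ck1 {n} {F : 'rV[R]_n.+1 -> R} t : is_Ck 1 setT F ->
  is_Ck 1 setT (slice F t) /\
  forall j : 'I_n, partial j (slice F t) = slice (partial (rshift 1 j : 'I_n.+1) F) t.
Proof.
move=> HF.
have E (j : 'I_n) y : is_derive y (delta_mx 0 j) (slice F t)
    (slice (partial (rshift 1 j : 'I_n.+1) F) t y).
  have /is_derive_lineP H := is_Ck_is_derive HF (rshift 1 j : 'I_n.+1)
    (row_mx (const_mx t : 'rV[R]_1) y) I.
  apply/is_derive_lineP; move: H; congr (is_derive _ _ _ _).
  apply/funext => h; rewrite /slice; congr F; apply/rowP => i.
  rewrite !mxE; case: (split_ordP (i : 'I_(1 + n))) => k ->.
    rewrite (_ : (lshift n k == rshift 1 j) = false); last exact: eq_lrshift.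
    by rewrite andbF mulr0 add0r.
  by rewrite (_ : (rshift 1 k == rshift 1 j) = (k == j)) ?mxE ?mxE//; exact: eq_rshift.
have c (G : 'rV[R]_n.+1 -> R) y : (forall x, {for x, continuous G}) ->
    {for y, continuous (slice G t)}.
  by move=> cG; apply: continuous_comp; [exact: row_mx_continuous|exact: cG].
split; last by move=> j; apply/funext => y; have [] := E j y.
apply: (is_CkS_intro (fun j => slice (partial (rshift 1 j : 'I_n.+1) F) t) openT).
- by move=> y _; apply: c => x; exact: is_Ck_cont HF x I.
- move=> j; apply/is_Ck0 => y _; apply: c => x.
  exact: is_Ck_cont (is_Ck_partial HF _) x I.
Qed.

Lemma partial_supp {n} {r : R} {F : 'rV[R]_n -> R} i :
  is_Ck 1 setT F -> cont_supp r F -> cont_supp (r + 1) (partial i F).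
Proof.
move=> HF [_ F0]; split=> [x|x rx]; first exact: is_Ck_cont (is_Ck_partial HF i) x I.
have oU : open [set x : 'rV[R]_n | r < `|x|].
  have -> : [set x : 'rV[R]_n | r < `|x|] = Num.norm @^-1` [set t | r < t] by [].
  by apply: open_comp (@open_gt _ r) => y _; exact: norm_continuous.
rewrite (@partial_eq_on _ _ _ F (fun=> 0) i oU) ?inE//=.
- exact: derive_cst.
- by move=> y; rewrite inE /= => ry; apply: F0; exact: ltW.
- by apply: lt_le_trans rx; rewrite ltrDl.
Qed.

(** For the first variable, by differentiation under the integral sign and the
    fundamental theorem of calculus; for the others, slice by slice. *)
Lemma integral_rV_partial {n} {r : R} {F : 'rV[R]_n -> R} i : 0 < r ->
  is_Ck 1 setT F -> cont_supp r F -> integral_rV (partial i F) = 0.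
Proof.
move=> r0; elim: n F i => [|n IH] F i HF cF; first by case: i.
have r1 : 0 < r + 1 by rewrite addr_gt0.
have cF1 : cont_supp (r + 1) F by apply: cont_suppW cF; rewrite lerDl.
have cdF := partial_supp i HF cF.
rewrite integral_rVS.
case: (split_ordP (i : 'I_(1 + n))) cdF => j ->; last first.
  move=> _; transitivity (\int[@lebesgue_measure R]_t ((cst 0 : R -> R) t)); last first.
    by rewrite Rintegral_cst// mul0r.
  apply: eq_Rintegral => t _.
  by have [H E] := slice_is_Ck1 t HF; rewrite -E; apply: IH (slice_supp t cF).
have -> : lshift n j = ord0 by apply/val_inj; rewrite /= (ord1 j).
move=> cdF.
apply: (cont_supp_Rintegral_derive r1 (integral_slice_supp r1 cF1)
  (integral_slice_supp r1 cdF)).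
by apply: (is_derive_integral_slice r1 cF1 cdF) => x; exact: is_Ck_is_derive HF _ _ I.
Qed.

End integral_rV_theory.

(** * Test functions and distributions *)

Section test_functions.
Context {R : realType} {N : nat}.
Implicit Types (U W K : set 'rV[R]_N) (f g h phi psi : 'rV[R]_N -> R).

Lemma test_fun_smooth {U phi} : test_fun U phi -> is_smooth setT phi.
Proof. by case=> K [_ _ []]. Qed.

Lemma test_fun_inM {K f phi} : is_smooth setT f -> test_fun_in K phi ->
  test_fun_in K (fun x => f x * phi x).
Proof.
move=> Hf [Hp p0]; split=> [k|x Kx]; first exact: is_CkM openT (Hf k) (Hp k).
by rewrite p0// mulr0.
Qed.

Lemma test_fun_in_partial {K phi} i : closed K -> test_fun_in K phi ->
  test_fun_in K (partial i phi).
Proof.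
move=> cK [Hp p0]; split=> [k|x Kx]; first exact: is_Ck_partial (Hp k.+1) i.
have oK : open (~` K) by exact: closed_openC.
rewrite (@partial_eq_on _ _ _ phi (fun=> 0) i oK) ?inE//.
  exact: derive_cst.
by move=> y; rewrite inE; exact: p0.
Qed.

Lemma test_fun_in0 K : test_fun_in K (fun=> 0 : R).
Proof. by split=> // k; exact: is_Ck_cst openT. Qed.

Lemma test_fun_in_lin {K phi psi} a : test_fun_in K phi -> test_fun_in K psi ->
  test_fun_in K (fun x => a * phi x + psi x).
Proof.
move=> [Hp p0] [Hq q0]; split=> [k|x Kx]; last by rewrite p0// q0// mulr0 addr0.
exact: is_CkD openT (is_CkZ a openT (Hp k)) (Hq k).
Qed.

Lemma test_fun_sub {U W phi} : U `<=` W -> test_fun U phi -> test_fun W phi.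
Proof. by move=> UW [K [cK KU Kp]]; exists K; split=> // x /KU/UW. Qed.

Lemma test_fun0 U : test_fun U (fun=> 0 : R).
Proof. by exists set0; split; [exact: compact0|by []|exact: test_fun_in0]. Qed.

Lemma test_fun_lin {U phi psi} a : test_fun U phi -> test_fun U psi ->
  test_fun U (fun x => a * phi x + psi x).
Proof.
move=> [K1 [cK1 KU1 H1]] [K2 [cK2 KU2 H2]]; exists (K1 `|` K2); split.
- exact: compactU.
- by rewrite subUset.
- apply: test_fun_in_lin; split; [exact: H1.1| |exact: H2.1|].
    by move=> x /not_orP[Kx _]; exact: H1.2.
  by move=> x /not_orP[_ Kx]; exact: H2.2.
Qed.

Lemma test_fun_in_sum {K} {I : Type} (s : seq I) {F : I -> 'rV[R]_N -> R} :
  (forall i, test_fun_in K (F i)) -> test_fun_in K (fun x => \sum_(i <- s) F i x).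
Proof.
move=> HF; split=> [k|x Kx].
  by apply: (is_Ck_sum _ _ openT) => i; exact: (HF i).1.
by apply: big1 => i _; exact: (HF i).2.
Qed.

Lemma test_fun_in_opDiv {K phi} {b : 'rV[R]_N -> 'M[R]_N} : closed K ->
  (forall i j, is_smooth setT (fun x => b x i j)) ->
  test_fun_in K phi -> test_fun_in K (opDiv b phi).
Proof.
move=> cK Hb Hp; apply: test_fun_in_sum => i; apply: test_fun_in_sum => j.
by apply: test_fun_in_partial => //; apply: test_fun_inM => //; exact: test_fun_in_partial.
Qed.

Lemma test_fun_opDiv {U phi} {b : 'rV[R]_N -> 'M[R]_N} :
  (forall i j, is_smooth setT (fun x => b x i j)) ->
  test_fun U phi -> test_fun U (opDiv b phi).
Proof.
move=> Hb [K [cK KU Kp]]; exists K; split; [exact: cK|exact: KU|].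
exact: test_fun_in_opDiv (rV_compact_closed cK) Hb Kp.
Qed.

Lemma test_fun_in_Ck {k W K h phi} : open W -> compact K -> K `<=` W ->
  is_Ck k W h -> test_fun_in K phi -> is_Ck k setT (fun x => h x * phi x).
Proof.
move=> oW cK KW Hh [Hp p0].
have oK : open (~` K) by exact: closed_openC (rV_compact_closed cK).
have -> : [set: 'rV[R]_N] = W `|` ~` K.
  by apply/seteqP; split=> // x _; case: (pselect (K x)) => Kx; [left; exact: KW|right].
apply: is_Ck_setU.
  by apply: (is_CkM oW Hh); exact: (is_Ck_sub (@subsetT _ W) (Hp k)).
apply: (is_Ck_eq_on oK _ (is_Ck_cst 0 oK)) => x; rewrite inE => Kx.
by rewrite p0// mulr0.
Qed.

Lemma test_fun_in_supp {W K h phi} : open W -> compact K -> K `<=` W ->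
  is_Ck 0 W h -> test_fun_in K phi ->
  exists2 r : R, 0 < r & cont_supp r (fun x => h x * phi x).
Proof.
move=> oW cK KW Hh Hp; have [r r0 Hr] := rV_compact_bounded cK.
exists r => //; split=> [x|x rx].
  exact: is_Ck_cont (test_fun_in_Ck oW cK KW Hh Hp) x I.
rewrite Hp.2 ?mulr0// => Kx.
by have := lt_le_trans (Hr _ Kx) rx; rewrite ltxx.
Qed.

Lemma cont_supp_common {f g} :
  (exists2 r : R, 0 < r & cont_supp r f) -> (exists2 r : R, 0 < r & cont_supp r g) ->
  exists r : R, [/\ 0 < r, cont_supp r f & cont_supp r g].
Proof.
move=> [r r0 Hf] [s s0 Hg]; exists (Num.max r s); split.
- by rewrite lt_max r0.
- by apply: cont_suppW Hf; rewrite le_max lexx.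
- by apply: cont_suppW Hg; rewrite le_max lexx orbT.
Qed.

(** Near a point where [g] is negative, test it against a cutoff function. *)
Lemma distr_ge0 {W g} : open W -> (forall x, W x -> {for x, continuous g}) ->
  (forall phi, test_fun W phi -> (forall x, 0 <= phi x) ->
    0 <= integral_rV (fun x => g x * phi x)) ->
  forall x, W x -> 0 <= g x.
Proof.
move=> oW cg H y Wy; rewrite leNgt; apply/negP => gy.
have : \forall x \near y, W x /\ g x < 0.
  near=> x; split; first by near: x; exact: open_nbhs_nbhs.
  by near: x; exact: (cvgr_lt _ (cg y Wy)).
move=> /nbhs_ballP[d /= d0 Hd].
have d20 : 0 < d / 2 by rewrite divr_gt0.
have [chi [chiS chi0 chip chi1 _]] := smooth_cutoff y (d / 2) d20.
pose K : set 'rV[R]_N := [set x | `|x - y| <= d / 2].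
have KB x : K x -> ball y d x.
  rewrite -ball_normE /ball_ /= distrC => /le_lt_trans; apply.
  by rewrite ltr_pdivrMr// ltr_pMr// ltr1n.
have cK : compact K by exact: cube_compact.
have Kchi : test_fun_in K chi.
  by split=> // x /negP; rewrite -ltNge => /ltW/chi1.
have KW : K `<=` W by move=> x /KB/Hd[].
have gW : is_Ck 0 W g by exact/is_Ck0.
have [r r0 [c1 c2]] := test_fun_in_supp oW cK KW gW Kchi.
have Hneg := cont_supp_lin (-1) (conj c1 c2) cont_supp0.
have : 0 < integral_rV (fun x => -1 * (g x * chi x) + 0).
  apply: (integral_rV_gt0 y r0 Hneg) => [x|].
    rewrite addr0 mulN1r oppr_ge0; case: (leP `|x - y| (d / 2)) => xy.
      by rewrite mulr_le0_ge0// ltW//; have [] := Hd x (KB x xy).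
    by rewrite chi1 ?mulr0// ltW.
  rewrite addr0 mulN1r oppr_gt0 nmulr_rlt0//; apply: chip.
  by rewrite subrr normr0.
rewrite (integral_rV_lin (-1) r0 (conj c1 c2) cont_supp0) integral_rV_cst0 addr0 mulN1r.
by rewrite oppr_gt0 ltNge H//; exists K.
Unshelve. all: by end_near. Qed.

Lemma distr_eq0 {W g} : open W -> (forall x, W x -> {for x, continuous g}) ->
  (forall phi, test_fun W phi -> integral_rV (fun x => g x * phi x) = 0) ->
  forall x, W x -> g x = 0.
Proof.
move=> oW cg H x Wx; apply/eqP; rewrite eq_le; apply/andP; split.
  rewrite -oppr_ge0; apply: (distr_ge0 (g := fun x => - g x) oW _ _ x Wx).
    by move=> y Wy; exact: continuousN (cg y Wy).
  move=> phi Hp p0; have [K [cK KW Kp]] := Hp.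
  have gW : is_Ck 0 W g by exact/is_Ck0.
  have [r r0 c] := test_fun_in_supp oW cK KW gW Kp.
  have := integral_rV_lin (-1) r0 c cont_supp0; rewrite integral_rV_cst0 H// mulr0 addr0.
  move=> E; rewrite -[X in X <= _]E le_eqVlt; apply/orP; left; apply/eqP.
  by congr integral_rV; apply/funext => y; rewrite mulN1r addr0 mulNr.
by apply: (distr_ge0 oW cg _ x Wx) => phi Hp _; rewrite H.
Qed.

Lemma integral_rV_sum {I : Type} (s : seq I) {F : I -> 'rV[R]_N -> R} {r : R} :
  0 < r -> (forall i, cont_supp r (F i)) ->
  integral_rV (fun x => \sum_(i <- s) F i x) = \sum_(i <- s) integral_rV (F i).
Proof.
move=> r0 HF.
have Hs s' : cont_supp r (fun x => \sum_(i <- s') F i x).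
  elim: s' => [|i s' IH].
    have -> : (fun x => \sum_(i <- [::]) F i x) = fun=> 0.
      by apply/funext => x; rewrite big_nil.
    exact: cont_supp0.
  have -> : (fun x => \sum_(i <- i :: s') F i x) =
      (fun x => 1 * F i x + \sum_(i <- s') F i x).
    by apply/funext => x; rewrite big_cons mul1r.
  exact: cont_supp_lin.
elim: s => [|i s IH].
  rewrite big_nil -[RHS](@integral_rV_cst0 R N); congr integral_rV.
  by apply/funext => x; rewrite big_nil.
rewrite big_cons -IH -[X in X + _]mul1r -(integral_rV_lin 1 r0 (HF i) (Hs s)).
by congr integral_rV; apply/funext => x; rewrite big_cons mul1r.
Qed.

(** Green's identity: by the symmetry of [b], the difference of the integrands is
    [sum_i D_i (sum_j F i j)], with [F i j] of class C^1 and compactly supported. *)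
Lemma integral_opDivC {W h phi} {b : 'rV[R]_N -> 'M[R]_N} : open W ->
  (forall i j, is_smooth setT (fun x => b x i j)) -> (forall x, (b x)^T = b x) ->
  is_Ck 2 W h -> test_fun W phi ->
  integral_rV (fun x => h x * opDiv b phi x) =
  integral_rV (fun x => opDiv b h x * phi x).
Proof.
move=> oW Hb bsym Hh [K [cK KW Kp]].
have clK := rV_compact_closed cK.
have Hh1 : is_Ck 1 W h := is_CkW (leqnSn 1) Hh.
pose F i j x := h x * (b x i j * partial j phi x) - b x i j * partial j h x * phi x.
have bphi i j : test_fun_in K (fun x => b x i j * partial j phi x).
  by apply: test_fun_inM => //; exact: test_fun_in_partial.
have bh i j : is_Ck 1 W (fun x => b x i j * partial j h x).
  by apply: (is_CkM oW _ (is_Ck_partial Hh j)); exact: is_Ck_sub (@subsetT _ W) (Hb i j 1%N).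
have F1 i j : is_Ck 1 setT (F i j).
  apply: (is_CkB openT); first exact: test_fun_in_Ck oW cK KW Hh1 (bphi i j).
  exact: test_fun_in_Ck oW cK KW (bh i j) Kp.
have [r r0 Hr] := rV_compact_bounded cK.
have Foff i j x : ~ K x -> F i j x = 0.
  by move=> Kx; rewrite /F (bphi i j).2// Kp.2// !mulr0 subrr.
have FS i j : cont_supp r (F i j).
  split=> [x|x rx]; first exact: is_Ck_cont (F1 i j) x I.
  by apply: Foff => Kx; have := lt_le_trans (Hr _ Kx) rx; rewrite ltxx.
have dF : integral_rV (fun x => \sum_i \sum_j partial i (F i j) x) = 0.
  have H i : cont_supp (r + 1) (fun x => \sum_j partial i (F i j) x).
    split=> [x|x rx]; last by apply: big1 => j _; exact: (partial_supp i (F1 i j) (FS i j)).2.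
    apply: is_Ck_cont (is_Ck_sum _ _ openT _) x I => // j.
    exact: is_Ck_partial (F1 i j) i.
  rewrite (integral_rV_sum _ (addr_gt0 r0 ltr01) H); apply: big1 => i _.
  rewrite (integral_rV_sum _ (addr_gt0 r0 ltr01) (fun j => partial_supp i (F1 i j) (FS i j))).
  by apply: big1 => j _; exact: integral_rV_partial r0 (F1 i j) (FS i j).
have E x : W x -> \sum_i \sum_j partial i (F i j) x =
    h x * opDiv b phi x - opDiv b h x * phi x.
  move=> Wx.
  have dE i j : partial i (F i j) x = h x * partial i (fun x => b x i j * partial j phi x) x
      - partial i (fun x => b x i j * partial j h x) x * phi x +
      (partial i h x * b x i j * partial j phi x - partial i phi x * b x i j * partial j h x).
    have d1 := is_deriveM (is_Ck_is_derive Hh1 i x Wx) (is_Ck_is_derive ((bphi i j).1 1%N) i x I).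
    have d2 := is_deriveM (is_Ck_is_derive (bh i j) i x Wx) (is_Ck_is_derive (Kp.1 1%N) i x I).
    have [_ d12] := is_deriveB d1 d2.
    have alg (a X dh bb pj hj dp p Y : R) :
        a * X + bb * pj * dh - (bb * hj * dp + p * Y) =
        a * X - Y * p + (dh * bb * pj - dp * bb * hj) by ring.
    by rewrite [LHS]d12; exact: alg.
  under eq_bigr do under eq_bigr do rewrite dE.
  under eq_bigr do rewrite big_split /= sumrB -mulr_sumr -mulr_suml.
  rewrite big_split /= sumrB -mulr_sumr -mulr_suml.
  under [X in _ + X]eq_bigr do rewrite sumrB.
  rewrite sumrB [X in _ + (_ - X)]exchange_big /=.
  rewrite [X in _ + (X - _)](eq_bigr (fun i => \sum_j partial j phi x * b x j i * partial i h x)).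
    by rewrite subrr addr0.
  move=> i _; apply: eq_bigr => j _.
  by rewrite -[in LHS]bsym mxE; ring.
have Hop : is_Ck 0 W (opDiv b h) := is_Ck_opDiv oW Hb Hh.
have [q [q0 C1 C2]] := cont_supp_common
  (test_fun_in_supp oW cK KW (is_CkW (leq0n _) Hh) (test_fun_in_opDiv clK Hb Kp))
  (test_fun_in_supp oW cK KW Hop Kp).
have := integral_rV_lin (-1) q0 C2 C1.
set J := (X in X = _ -> _); have -> : J = 0.
  rewrite -[RHS]dF; congr integral_rV; apply/funext => x.
  case: (pselect (W x)) => Wx; first by rewrite E// mulN1r addrC.
  have Kx : ~ K x by move=> /KW.
  rewrite (test_fun_in_opDiv clK Hb Kp).2// Kp.2// !mulr0 addr0; symmetry.
  apply: big1 => i _; apply: big1 => j _.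
  have oK : open (~` K) by exact: closed_openC.
  rewrite (@partial_eq_on _ _ _ (F i j) (fun=> 0) i oK) ?inE//; first exact: derive_cst.
  by move=> y; rewrite inE; exact: Foff.
by move=> /eqP; rewrite mulN1r eq_sym addrC subr_eq0 => /eqP.
Qed.

End test_functions.

(** [opDiv b] being formally self-adjoint, [T (opDiv b phi)] is the value at [phi]
    of the distribution [opDiv b T]. *)
Definition opDiv_hypoelliptic {R : realType} {N} (b : 'rV[R]_N -> 'M[R]_N) : Prop :=
  forall (W : set 'rV[R]_N) (T : functional R N) f, open W ->
  is_distribution W T -> is_smooth W f ->
  (forall phi, test_fun W phi ->
     T (opDiv b phi) = integral_rV (fun x => f x * phi x)) ->
  exists2 g, is_smooth W g &
    forall phi, test_fun W phi -> T phi = integral_rV (fun x => g x * phi x).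

Section distributions.
Context {R : realType} {N : nat}.
Implicit Types (W K : set 'rV[R]_N) (T : functional R N).

Lemma distribution0 {W T} : is_distribution W T -> T (fun=> 0) = 0.
Proof.
move=> [lin _]; have := lin 1 _ _ (test_fun0 W) (test_fun0 W).
rewrite (_ : (fun x => 1 * 0 + 0) = fun=> 0); last first.
  by apply/funext => x; rewrite mulr0 addr0.
by rewrite mul1r => /eqP; rewrite -subr_eq0 opprD addNKr oppr_eq0 => /eqP.
Qed.

Lemma distributionN {W T phi} : is_distribution W T -> test_fun W phi ->
  T (fun x => -1 * phi x + 0) = - T phi.
Proof.
move=> HT Hphi; rewrite (HT.1 (-1) _ _ Hphi (test_fun0 W)) (distribution0 HT).
by rewrite addr0 mulN1r.
Qed.

(** Apply the hypothesis to [phi] and to [- phi]: a positive functional whose sign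
    depends on the values on [Z] only is supported by [Z]. *)
Lemma distribution_supp {W Z T} : is_distribution W T ->
  (forall phi, test_fun W phi -> (forall x, Z x -> phi x <= 0) -> T phi <= 0) ->
  forall phi, test_fun W phi -> (forall x, Z x -> phi x = 0) -> T phi = 0.
Proof.
move=> HT Tpos phi Hphi phi0; apply/eqP; rewrite eq_le; apply/andP; split.
  by apply: Tpos => // x Zx; rewrite phi0.
rewrite -oppr_le0 -(distributionN HT Hphi).
apply: (Tpos _ (test_fun_lin (-1) Hphi (test_fun0 W))) => x Zx.
by rewrite phi0// mulr0 addr0.
Qed.

Lemma distribution_sum {W K T} {I : Type} (s : seq I) {F : I -> 'rV[R]_N -> R} :
  is_distribution W T -> compact K -> K `<=` W -> (forall i, test_fun_in K (F i)) ->
  T (fun x => \sum_(i <- s) F i x) = \sum_(i <- s) T (F i).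
Proof.
move=> HT cK KW HF; have [Tlin _] := HT; have T0 := distribution0 HT.
have HW phi : test_fun_in K phi -> test_fun W phi by move=> H; exists K.
elim: s => [|i s IH].
  by rewrite big_nil -[RHS]T0; congr T; apply/funext => x; rewrite big_nil.
rewrite big_cons -IH -[X in X + _]mul1r -Tlin; last 2 first.
- exact: HW (HF i).
- exact: HW (test_fun_in_sum s HF).
by congr T; apply/funext => x; rewrite big_cons mul1r.
Qed.

Variables (V : 'rV[R]_N -> R) (A : 'rV[R]_N -> 'M[R]_N).
Hypotheses (V_smooth : is_smooth setT V) (V_pos : forall x, 0 < V x)
  (A_smooth : forall i j, is_smooth setT (fun x => A x i j))
  (A_sym : forall x, (A x)^T = A x).

Let b x := V x *: A x.

Let b_smooth i j : is_smooth setT (fun x => b x i j).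
Proof.
move=> k; apply: (is_Ck_eq_on openT _ (is_CkM openT (V_smooth k) (A_smooth i j k))).
by move=> x _; rewrite mxE.
Qed.

Let opDiv_b f : opDiv b f =
  fun x => \sum_i \sum_j partial i (fun y => V y * A y i j * partial j f y) x.
Proof.
apply/funext => x; apply: eq_bigr => i _; apply: eq_bigr => j _.
by congr (partial i _ x); apply/funext => y; rewrite mxE.
Qed.

Lemma opL_opDiv u x : opL V A u x = (V x)^-1 * opDiv b u x.
Proof. by rewrite opDiv_b. Qed.

Lemma distr_opLE {W T phi} : is_distribution W T -> test_fun W phi ->
  distr_opL V A T phi = T (opDiv b (fun x => (V x)^-1 * phi x)).
Proof.
move=> HT [K [cK KW Kp]]; have clK := rV_compact_closed cK.
have Vinv : is_smooth setT (fun x => (V x)^-1).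
  by move=> k; apply: (is_CkV openT _ (V_smooth k)) => x _; rewrite gt_eqF.
set psi := fun x => _; have Kpsi : test_fun_in K psi by exact: test_fun_inM.
have KF i j : test_fun_in K (partial i (fun y => b y i j * partial j psi y)).
  exact: test_fun_in_partial i clK
    (test_fun_inM (b_smooth i j) (test_fun_in_partial j clK Kpsi)).
rewrite (distribution_sum _ HT cK KW (fun i => test_fun_in_sum _ (KF i))).
under [RHS]eq_bigr do rewrite (distribution_sum _ HT cK KW (KF _)).
rewrite exchange_big /=.
apply: eq_bigr => i _; apply: eq_bigr => j _.
rewrite /distr_partial /distr_mul opprK; congr (T (partial _ _)).
by apply/funext => y; rewrite -A_sym !mxE.
Qed.

(** [opL V A] is [opDiv b] divided by the nonvanishing smooth function [V], so
    that both operators are hypoelliptic at the same time. *)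
Lemma opL_hypoelliptic_opDiv :
  (forall W, open W -> hypoelliptic (distr_opL V A) W) -> opDiv_hypoelliptic b.
Proof.
move=> hyp W T f oW HT Hf Tf.
have Vinv : is_smooth setT (fun x => (V x)^-1).
  by move=> k; apply: (is_CkV openT _ (V_smooth k)) => x _; rewrite gt_eqF.
have [||g [gS gT]] := hyp W oW T HT W oW (@subset_refl _ W) (fun x => f x * (V x)^-1).
- by move=> k; apply: (is_CkM oW (Hf k)); exact: is_Ck_sub (@subsetT _ W) (Vinv k).
- move=> phi Hp; have [K [cK KW Kp]] := Hp.
  rewrite (distr_opLE HT Hp) Tf; last first.
    by exists K; split; [exact: cK|exact: KW|exact: test_fun_inM Vinv Kp].
  by congr integral_rV; apply/funext => x; rewrite mulrA.
by exists g.
Qed.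

End distributions.
(** * The Hahn-Banach theorem *)

Section hahn_banach.
Context {R : realType} {E : lmodType R}.
Variables (D : set E) (p : E -> R).
Hypotheses (D_lin : forall a u v, D u -> D v -> D (a *: u + v))
  (pD : forall u v, D u -> D v -> p (u + v) <= p u + p v)
  (pZ : forall a u, 0 <= a -> D u -> p (a *: u) = a * p u).

(** The graph of a linear map, defined on a subspace of [D] and dominated by
    [p]; that it is the graph of a function is a consequence. *)
Definition dominated_graph (G : set (E * R)) : Prop :=
  [/\ G (0, 0), forall a x y, G x -> G y -> G (a *: x.1 + y.1, a * x.2 + y.2) &
      forall x, G x -> D x.1 /\ x.2 <= p x.1].

(** The value [c] at [w] has to lie between all [x.2 - p (x.1 - w)] and all
    [p (y.1 + w) - y.2]; subadditivity makes this possible, with [c] the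
    supremum of the former. *)
Let graph_extend G w : dominated_graph G -> D w ->
  exists c, dominated_graph
    [set x | exists y a, G y /\ x = (y.1 + a *: w, y.2 + a * c)].
Proof.
move=> [G0 Glin Gdom] Dw.
have D0 : D 0 by have [] := Gdom _ G0.
have DZ a u : D u -> D (a *: u) by move=> Du; rewrite -[_ *: _]addr0; exact: D_lin.
have DD u v : D u -> D v -> D (u + v).
  by move=> Du Dv; rewrite -[u]scale1r; exact: D_lin.
pose S := [set x.2 - p (x.1 - w) | x in G].
have Sub y : G y -> ubound S (p (y.1 + w) - y.2).
  move=> Gy _ [x Gx <-]; have [Dx _] := Gdom _ Gx; have [Dy _] := Gdom _ Gy.
  rewrite lerBrDr addrAC lerBlDr.
  have [_ /= le1] := Gdom _ (Glin 1 _ _ Gx Gy); rewrite mul1r scale1r in le1.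
  apply: le_trans le1 _; rewrite addrC.
  have -> : y.1 + x.1 = (y.1 + w) + (x.1 - w) by rewrite addrACA subrr addr0.
  by apply: pD; apply: DD => //; rewrite -scaleN1r; exact: DZ.
have S0 : S !=set0 by exists (0 - p (0 - w)); exists (0, 0).
pose c := sup S; exists c.
have c1 x : G x -> x.2 - p (x.1 - w) <= c.
  move=> Gx; apply: ub_le_sup; last by exists x.
  by exists (p (0 + w) - 0); exact: (Sub _ G0).
have c2 x : G x -> c <= p (x.1 + w) - x.2 by move=> Gx; apply: ge_sup S0 (Sub _ Gx).
have GZ a x : G x -> G (a *: x.1, a * x.2).
  by move=> Gx; have := Glin a _ _ Gx G0; rewrite /= !addr0.
split.
- by exists (0, 0), 0; rewrite scale0r mul0r !addr0.
- move=> a _ _ [x [s [Gx ->]]] [y [t [Gy ->]]] /=.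
  exists (a *: x.1 + y.1, a * x.2 + y.2), (a * s + t); split; first exact: Glin.
  by rewrite scalerDr scalerA scalerDl mulrDr mulrDl mulrA !addrA;
    congr (_, _); rewrite -!addrA; congr (_ + _); rewrite addrCA.
- move=> _ [x [a [Gx ->]]] /=; have [Dx px] := Gdom _ Gx.
  split; first by rewrite addrC; exact: D_lin.
  have [a0|a0|->] := ltgtP a 0; last by rewrite scale0r mul0r !addr0.
  + have na0 : 0 < - a by rewrite oppr_gt0.
    have := c1 _ (GZ (- a)^-1 _ Gx) => /=.
    have -> : (- a)^-1 *: x.1 - w = (- a)^-1 *: (x.1 + a *: w).
      by rewrite scalerDr scalerA invrN mulNr mulVf ?lt_eqF// scaleN1r.
    rewrite pZ ?invr_ge0 ?(ltW na0)//; last by rewrite addrC; exact: D_lin.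
    rewrite -mulrBr ler_pdivrMl// mulNr lerBlDr => H.
    by rewrite -lerBrDr addrC.
  + have := c2 _ (GZ a^-1 _ Gx) => /=.
    have -> : a^-1 *: x.1 + w = a^-1 *: (x.1 + a *: w).
      by rewrite scalerDr scalerA mulVf ?gt_eqF// scale1r.
    rewrite pZ ?invr_ge0 ?(ltW a0)//; last by rewrite addrC; exact: D_lin.
    by rewrite -mulrBr ler_pdivlMl// lerBrDr addrC.
Qed.

(** A maximal dominated graph containing [G0], given by Zorn's lemma, is defined on
    all of [D] by [graph_extend]. *)
Theorem hahn_banach (G0 : set (E * R)) : dominated_graph G0 ->
  exists T : E -> R, [/\ forall x, G0 x -> T x.1 = x.2,
    forall a u v, D u -> D v -> T (a *: u + v) = a * T u + T v &
    forall u, D u -> T u <= p u].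
Proof.
move=> dG0; have [G00 G0lin G0dom] := dG0.
(* [A `|` G0] rather than [A], for the sake of the empty chain *)
have [A [PA Amax]] : exists A, dominated_graph (A `|` G0) /\
    forall B, A `<` B -> ~ dominated_graph (B `|` G0).
  apply: (Zorn_bigcup (P := fun A => dominated_graph (A `|` G0))) => F FP tF.
  split; first by right.
  - move=> a x y Hx Hy.
    have up X z : F X -> (X `|` G0) z -> ((\bigcup_(X in F) X) `|` G0) z.
      by move=> FX [Xz|]; [left; exists X|right].
    case: Hx => [[X FX Xx]|Gx]; case: Hy => [[Y FY Yy]|Gy].
    + have [XY|YX] := tF _ _ FX FY.
        apply: (up Y) => //; have [_ l _] := FP _ FY.
        by apply: l; left => //; exact: XY.
      apply: (up X) => //; have [_ l _] := FP _ FX.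
      by apply: l; left => //; exact: YX.
    + by apply: (up X) => //; have [_ l _] := FP _ FX; apply: l; [left|right].
    + by apply: (up Y) => //; have [_ l _] := FP _ FY; apply: l; [right|left].
    + by right; exact: G0lin.
  - move=> x [[X FX Xx]|]; last exact: G0dom.
    by have [_ _ d] := FP _ FX; apply: d; left.
pose G := A `|` G0; have [GG0 Glin Gdom] := PA; rewrite -/G in GG0 Glin Gdom.
have Gtot w : D w -> exists s, G (w, s).
  move=> Dw; apply: contrapT => nG.
  have [c dG'] := graph_extend _ _ PA Dw.
  set G' := (X in dominated_graph X) in dG'.
  have GG' : G `<=` G'.
    by move=> x Gx; exists x, 0; split=> //; rewrite scale0r mul0r !addr0; case: (x).
  apply: (Amax G'); last first.
    by have -> : G' `|` G0 = G' by apply/setUidPl => x Gx; apply: GG'; right.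
  split; first by move=> x Ax; apply: GG'; left.
  move=> G'A; apply: nG; exists c; left; apply: G'A.
  by exists (0, 0), 1; split=> //=; rewrite scale1r mul1r !add0r.
have p0 : p 0 = 0.
  have [D0 _] := Gdom _ GG0.
  by have := pZ 0 _ (lexx 0) D0; rewrite scale0r mul0r.
have Gfun u s t : G (u, s) -> G (u, t) -> s <= t.
  move=> Gs Gt; have [_] := Gdom _ (Glin (-1) _ _ Gt Gs) => /=.
  by rewrite scaleN1r addNr p0 mulN1r addrC subr_le0.
pose T u := xget 0 [set s | G (u, s)].
have TG u : D u -> G (u, T u).
  by move=> /Gtot[s Gs]; rewrite /T; case: xgetP => [_ _ //|/(_ s)/(_ Gs)].
have TE u s : G (u, s) -> T u = s.
  move=> Gs; have [Du _] := Gdom _ Gs.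
  by apply/eqP; rewrite eq_le !(Gfun u)//; exact: TG.
exists T; split.
- by move=> [u s] Gx; apply: TE; right.
- move=> a u v Du Dv; apply: TE.
  exact: (Glin a _ _ (TG _ Du) (TG _ Dv)).
- by move=> u /TG/Gdom[].
Qed.

End hahn_banach.

#[local] Opaque opDiv partial.

(** * Green functionals on penalizable sets *)

(** The setting is a cube, on which the maximum principle is controlled by the
    barrier [psi] and where penalties are subsolutions up to a zero-order term
    with coefficient [kappa]. *)
Section penalizable_sets.
Context {R : realType} {N : nat}.
Variables (b : 'rV[R]_N -> 'M[R]_N) (U : set 'rV[R]_N) (y : 'rV[R]_N)
  (r kappa : R) (psi : 'rV[R]_N -> R) (C : R).
Hypotheses (b_smooth : forall i j, is_smooth setT (fun x => b x i j))
  (b_sym : forall x, (b x)^T = b x) (b_psd : forall x, pos_semidef (b x))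
  (U_open : open U) (cubeU : [set x | `|x - y| <= r] `<=` U)
  (kappa_gt0 : 0 < kappa) (psi_smooth : is_smooth setT psi)
  (psi_sup : forall x, `|x - y| <= r -> 1 <= opDiv b psi x)
  (psi_ge0 : forall x, 0 <= psi x)
  (psi_le : forall x, `|x - y| <= r -> psi x <= C).

(** Adding a large multiple of such an almost subsolution to a function penalizes
    the points outside [Z] without creating new interior maxima. *)
Definition penalty (Z : set 'rV[R]_N) (w : 'rV[R]_N -> R) : Prop :=
  [/\ is_Ck 2 U w, forall x, `|x - y| <= r -> w x <= 0,
      forall x, `|x - y| <= r -> kappa * w x <= opDiv b w x &
      forall x, Z x -> w x = 0].

(** Closed sets off which every point is penalized. The zero set in the cube of a
    single penalty is of this kind, and the frontier of that set turns out to be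
    so as well. *)
Definition penalizable (Z : set 'rV[R]_N) : Prop :=
  [/\ closed Z, Z `<=` [set x | `|x - y| <= r] &
      forall x, `|x - y| <= r -> ~ Z x -> exists2 w, penalty Z w & w x < 0].

Lemma penalty0 Z : penalty Z (fun=> 0).
Proof.
have H0 := is_Ck_cst 0 U_open.
split; [exact: H0|by move=> x _|move=> x _|by move=> x _].
by rewrite mulr0 opDiv_cst lexx.
Qed.

Lemma penaltyD Z w1 w2 : penalty Z w1 -> penalty Z w2 ->
  penalty Z (fun x => 1 * w1 x + w2 x).
Proof.
move=> [S1 N1 L1 Z1] [S2 N2 L2 Z2]; split.
- exact: is_CkD U_open (is_CkZ 1 U_open S1) S2.
- by move=> x xr; rewrite mul1r -[leRHS]addr0 lerD ?N1 ?N2.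
- move=> x xr; rewrite (opDiv_lin 1 U_open b_smooth S1 S2 x (cubeU _ xr)) !mul1r.
  by rewrite mulrDr lerD// ?L1 ?L2.
- by move=> x Zx; rewrite Z1// Z2// mulr0 addr0.
Qed.

(** A sum of finitely many penalties, by compactness. *)
Lemma compact_penalty Z K : penalizable Z -> compact K ->
  K `<=` [set x | `|x - y| <= r] -> K `&` Z = set0 ->
  exists2 w, penalty Z w & forall x, K x -> w x < 0.
Proof.
move=> [_ _ sepZ] cK Kcube KZ.
have KnZ x : K x -> ~ Z x.
  by move=> Kx Zx; have : (K `&` Z) x by []; rewrite KZ.
have /choice[w Hw] : forall x, exists w, K x -> penalty Z w /\ w x < 0.
  move=> x; case: (pselect (K x)) => Kx; last by exists (fun=> 0) => ?.
  by have [w pw wx] := sepZ x (Kcube _ Kx) (KnZ _ Kx); exists w => _; exact: conj pw wx.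
have [D' D'K Kcov] : finite_subset_cover K (fun x => [set z | U z /\ w x z < 0]) K.
  move: cK; rewrite compact_cover; apply; last first.
    by move=> x Kx; exists x => //; split; [exact/cubeU/Kcube|have [] := Hw x Kx].
  move=> x Kx; have [[Sw _ _ _] _] := Hw x Kx.
  rewrite openE => z [Uz wz]; near=> z'; split.
    by near: z'; exact: open_nbhs_nbhs.
  by near: z'; exact: (cvgr_lt _ (is_Ck_cont Sw z Uz)).
have [W pW WN] : exists2 W, penalty Z W &
    forall x z, x \in finmap.enum_fset D' -> `|z - y| <= r -> w x z < 0 -> W z < 0.
  have : {subset finmap.enum_fset D' <= K} by move=> x /D'K.
  elim: (finmap.enum_fset D') => [|x s IH] sK.
    by exists (fun=> 0); [exact: penalty0|move=> ? ?].
  have [|W pW WN] := IH; first by move=> z zs; apply: sK; rewrite inE zs orbT.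
  have /Hw[pw _] : K x by apply/set_mem/sK; rewrite inE eqxx.
  exists (fun z => 1 * w x z + W z); first exact: penaltyD _ _ _ pw pW.
  move=> x' z; rewrite inE => /predU1P[->|x's] zr wz; rewrite mul1r.
    by rewrite -[ltRHS]addr0 ltr_leD//; case: pW => _ /(_ z zr).
  rewrite -[ltRHS]addr0 ler_ltD//; last exact: WN x's zr wz.
  by case: pw => _ /(_ z zr).
exists W => // z Kz; have [x /= xD [Uz wz]] := Kcov z Kz.
exact: WN xD (Kcube _ Kz) wz.
Unshelve. all: by end_near. Qed.

(** The a priori estimate [phi <= C sup_Z (opDiv b phi)^-] on [Z]. If it failed,
    then for some [t] slightly larger than the supremum [Phi = phi + t psi]
    would satisfy [opDiv b Phi >= e > 0] on [Z] and have a maximum [m] over [Z]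
    larger than its values on the boundary of the cube, which are at most [C t].
    Add a penalty [k W], with [k] so large that the sum is less than [m] away
    from a neighbourhood of [Z] where [opDiv b Phi > e / 2] and
    [Phi < m + eta]. The maximum of [Phi + k W] over the cube is at least [m],
    hence is attained in this neighbourhood and in the interior of the cube. There
    [0 >= opDiv b (Phi + k W) > e / 2 + kappa k W], so that
    [k W < - e / (2 kappa) = - eta] and [Phi + k W < m], a contradiction. *)
Lemma penalizable_estimate Z phi (s : R) : penalizable Z ->
  test_fun [set x | `|x - y| < r] phi -> 0 <= s ->
  (forall x, Z x -> - opDiv b phi x <= s) ->
  forall z, Z z -> phi z <= C * s.
Proof.
move=> tZ [K [cK KB Kphi]] s0 Hs z Zz.
have [clZ Zcube sepZ] := tZ.
pose cube := [set x : 'rV[R]_N | `|x - y| <= r].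
have ccube : compact cube by exact: cube_compact.
have C0 : 0 <= C by exact: le_trans (psi_ge0 z) (psi_le _ (Zcube z Zz)).
apply/ler_addgt0Pl => /= e' e'0.
pose e := e' / (C + 1).
have e0 : 0 < e by rewrite divr_gt0// ltr_wpDl.
suff : phi z <= C * (s + e).
  move=> /le_trans; apply; rewrite mulrDr addrC lerD2r /e mulrA ler_pdivrMr ?ltr_wpDl//.
  by rewrite mulrC ler_wpM2l ?(ltW e'0)// lerDl.
rewrite leNgt; apply/negP => phiz.
pose t := s + e; have t0 : 0 <= t by rewrite addr_ge0// ltW.
pose Phi x := t * psi x + phi x.
have phi2 : is_Ck 2 setT phi := Kphi.1 2%N.
have Phi2 : is_Ck 2 setT Phi := is_CkD openT (is_CkZ t openT (psi_smooth 2%N)) phi2.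
have LPhi x : opDiv b Phi x = t * opDiv b psi x + opDiv b phi x.
  exact: (opDiv_lin t openT b_smooth (psi_smooth 2%N) phi2 x I).
have cPhi x : {for x, continuous Phi} := is_Ck_cont Phi2 x I.
have cLPhi : continuous (opDiv b Phi).
  by move=> x; exact: is_Ck_cont (is_Ck_opDiv openT b_smooth Phi2) x I.
have cZ : compact Z by exact: subclosed_compact ccube Zcube.
have [z0] : exists2 c, c \in Z & forall t, t \in Z -> Phi t <= Phi c.
  by apply: EVT_max_rV => //; [exists z|exact: continuous_subspaceT].
rewrite inE => Zz0 maxZ; pose m := Phi z0.
have mC : C * t < m.
  apply: lt_le_trans (maxZ z _); last by rewrite inE.
  by apply: lt_le_trans phiz _; rewrite lerDr mulr_ge0.
have LZ x : Z x -> e <= opDiv b Phi x.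
  move=> Zx; rewrite LPhi; have p1 := psi_sup _ (Zcube x Zx); have p2 := Hs x Zx.
  have p3 : t <= t * opDiv b psi x by rewrite ler_peMr.
  rewrite -[leLHS](addrK s) [e + s]addrC; apply: (lerD p3).
  by rewrite lerNl.
pose eta := e / (2 * kappa).
have eta0 : 0 < eta by rewrite divr_gt0// mulr_gt0.
pose K' := cube `&` [set x | opDiv b Phi x <= e / 2 \/ m + eta <= Phi x].
have K'Z : K' `&` Z = set0.
  rewrite -subset0 => x [[_ [H|H]] Zx].
    have := le_trans (LZ x Zx) H.
    by rewrite leNgt ltr_pdivrMr// ltr_pMr// ltr1n.
  have : Phi x <= m by apply: maxZ; rewrite inE.
  by move=> /(le_trans H); rewrite gerDl leNgt eta0.
have clK' : closed [set x | opDiv b Phi x <= e / 2 \/ m + eta <= Phi x].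
  have -> : [set x | opDiv b Phi x <= e / 2 \/ m + eta <= Phi x] =
      opDiv b Phi @^-1` [set t | t <= e / 2] `|` Phi @^-1` [set t | m + eta <= t].
    by [].
  apply: closedU.
    by apply: preimage_closed (@closed_le _ _) => x _; exact: cLPhi.
  by apply: preimage_closed (@closed_ge _ _) => x _; exact: cPhi.
have cK' : compact K' by exact: compact_closedI.
have [W pW WK'] := compact_penalty _ _ tZ cK' (@subIsetl _ _ _) K'Z.
have [W2 WN WL WZ] := pW.
have cW x : cube x -> {for x, continuous W} by move=> xr; exact: is_Ck_cont W2 x (cubeU _ xr).
have within_cont (f : 'rV[R]_N -> R) (A : set 'rV[R]_N) :
    (forall x, A x -> {for x, continuous f}) -> {within A, continuous f}.
  by move=> H; apply: continuous_in_subspaceT => x; rewrite inE; exact: H.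
have [k k0 Hk] : exists2 k : R, 0 <= k & forall x, K' x -> Phi x + k * W x < m.
  have [K'0|/set0P K'0] := eqVneq K' set0.
    by exists 0 => // x; rewrite K'0.
  have [w0] : exists2 c, c \in K' & forall t, t \in K' -> W t <= W c.
    by apply: EVT_max_rV => //; apply: within_cont => x [xr _]; exact: cW.
  rewrite inE => K'w0 maxW.
  have [p0] : exists2 c, c \in K' & forall t, t \in K' -> Phi t <= Phi c.
    by apply: EVT_max_rV => //; exact: within_cont.
  rewrite inE => K'p0 maxP.
  have Ww0 := WK' _ K'w0.
  pose k := (`|Phi p0 - m| + 1) / - W w0.
  have k0 : 0 <= k by rewrite divr_ge0 ?addr_ge0// oppr_ge0 ltW.
  exists k => // x K'x.
  have H1 : Phi x <= Phi p0 by apply: maxP; rewrite inE.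
  have H2 : k * W x <= k * W w0 by rewrite ler_wpM2l// maxW// inE.
  have H3 : k * W w0 = - (`|Phi p0 - m| + 1).
    by rewrite /k invrN mulrN mulNr divfK// lt_eqF.
  apply: le_lt_trans (lerD H1 H2) _; rewrite H3 ltrBlDr -ltrBlDl.
  by apply: le_lt_trans (ler_norm _) _; rewrite ltrDl.
pose Psi x := k * W x + Phi x.
have [x1] : exists2 c, c \in cube & forall t, t \in cube -> Psi t <= Psi c.
  apply: EVT_max_rV => //; first by exists z; exact: Zcube.
  apply: within_cont => x xr; apply: continuousD (cPhi x).
  by apply: continuousM (cW x xr); exact: cst_continuous.
rewrite inE => x1r max1.
have m1 : m <= Psi x1.
  have := max1 z0; rewrite inE => /(_ (Zcube _ Zz0)).
  by rewrite {1}/Psi WZ// mulr0 add0r.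
have nK' : ~ K' x1.
  by move=> /Hk; rewrite addrC ltNge => /negP; apply.
have [L1 P1] : e / 2 < opDiv b Phi x1 /\ Phi x1 < m + eta.
  by split; rewrite ltNge; apply/negP => H; apply: nK'; split=> //; [left|right].
have kW0 : k * W x1 <= 0 by rewrite mulr_ge0_le0// WN.
move: (x1r); rewrite /cube /= le_eqVlt => /predU1P[x1b|x1i].
  have phi0 : phi x1 = 0.
    by apply: Kphi.2 => /KB /=; rewrite x1b ltxx.
  have : Psi x1 <= t * C.
    rewrite /Psi /Phi phi0 addr0 -[leRHS]add0r lerD// ler_wpM2l//.
    exact: psi_le.
  by rewrite mulrC leNgt (lt_le_trans mC m1).
have oB := cube_open y r.
pose B : set 'rV[R]_N := [set x | `|x - y| < r].
have BU : B `<=` U by move=> x /ltW xr; exact: cubeU.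
have WB : is_Ck 2 B W := is_Ck_sub BU W2.
have PB : is_Ck 2 B Phi := is_Ck_sub (@subsetT _ B) Phi2.
have maxB : max_at B Psi x1.
  by split=> // x /ltW xr; apply: max1; rewrite inE.
have := opDiv_le0_at_max oB b_smooth (b_sym x1) (b_psd x1)
  (is_CkD oB (is_CkZ k oB WB) PB) maxB.
rewrite (opDiv_lin k oB b_smooth WB PB x1 x1i) => L0.
have LW : kappa * (k * W x1) <= k * opDiv b W x1.
  rewrite mulrCA; apply: (ler_wpM2l k0); exact: WL _ (ltW x1i).
have : kappa * (k * W x1) < - (e / 2).
  apply: le_lt_trans LW _; apply: (@le_lt_trans _ _ (- opDiv b Phi x1)).
    by rewrite -subr_le0 opprK.
  by rewrite ltrN2.
rewrite -ltr_pdivlMl// => kW.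
have : kappa^-1 * - (e / 2) = - eta by rewrite /eta; field; rewrite gt_eqF.
move=> E; rewrite E in kW; have := le_lt_trans m1 (ltrD kW P1).
by rewrite addrCA addNr addr0 ltxx.
Qed.

Let B : set 'rV[R]_N := [set x | `|x - y| < r].

(** The bound on [l] says that the linear form [- opDiv b phi |-> l phi] is well
    defined and dominated by [p g = c sup_Z g^+]. Any linear extension dominated
    by [p] is nonpositive on the functions that are nonpositive on [Z], and is a
    distribution of order 0; it solves [opDiv b T = - l] in the cube. *)
Lemma green_functional Z (l : functional R N) (c : R) : penalizable Z -> Z !=set0 -> 0 <= c ->
  (forall a phi1 phi2, test_fun B phi1 -> test_fun B phi2 ->
    l (fun x => a * phi1 x + phi2 x) = a * l phi1 + l phi2) ->
  (forall phi (s : R), test_fun B phi -> 0 <= s ->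
    (forall x, Z x -> - opDiv b phi x <= s) -> l phi <= c * s) ->
  exists T : functional R N,
    [/\ forall W, W `<=` B -> is_distribution W T,
        forall phi, test_fun B phi -> T (opDiv b phi) = - l phi &
        forall phi, test_fun B phi -> (forall x, Z x -> phi x <= 0) -> T phi <= 0].
Proof.
move=> [clZ Zcube _] Z0 c0 l_lin l_le.
have cZ : compact Z by exact: subclosed_compact clZ (cube_compact y r) Zcube.
pose D : set ('rV[R]_N -> R) := [set g | exists M : R, forall x, Z x -> `|g x| <= M].
pose pos (g : 'rV[R]_N -> R) : R := sup [set Num.max (g x) 0 | x in Z].
have pos_ub g x : D g -> Z x -> Num.max (g x) 0 <= pos g.
  move=> [M HM] Zx; apply: ub_le_sup; last by exists x.
  exists M => _ [z Zz <-]; rewrite ge_max (le_trans (ler_norm _) (HM z Zz)).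
  exact: le_trans (normr_ge0 _) (HM z Zz).
have pos_le g (s : R) : 0 <= s -> (forall x, Z x -> g x <= s) -> pos g <= s.
  move=> s0 gs; apply: ge_sup.
    by have [z Zz] := Z0; exists (Num.max (g z) 0); exists z.
  by move=> _ [z Zz <-]; rewrite ge_max gs// s0.
have pos_ge0 g : D g -> 0 <= pos g.
  move=> Dg; have [z Zz] := Z0; apply: le_trans (pos_ub g z Dg Zz).
  by rewrite le_max lexx orbT.
have pos_gex g x : D g -> Z x -> g x <= pos g.
  by move=> Dg Zx; apply: le_trans (pos_ub g x Dg Zx); rewrite le_max lexx.
have D_lin a u v : D u -> D v -> D (a *: u + v).
  move=> [M HM] [M' HM']; exists (`|a| * M + M') => x Zx.
  apply: le_trans (ler_normD _ _) _; apply: lerD; last exact: HM'.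
  by rewrite normrM; apply: ler_wpM2l => //; exact: HM.
have D_test phi : (forall x, {for x, continuous phi}) -> D phi.
  move=> cphi; have /compact_bounded[M [_ HM]] : compact (phi @` Z).
    by apply: continuous_compact => //; apply: continuous_subspaceT.
  exists (M + 1) => x Zx; apply: (HM (M + 1)); first by rewrite ltrDl.
  by exists x.
pose p g := c * pos g.
have pD u v : D u -> D v -> p (u + v) <= p u + p v.
  move=> Du Dv; rewrite /p -mulrDr ler_wpM2l//; apply: pos_le.
    by rewrite addr_ge0 ?pos_ge0.
  by move=> x Zx; apply: lerD; exact: pos_gex.
have pZ a u : 0 <= a -> D u -> p (a *: u) = a * p u.
  move=> a0 Du; rewrite /p mulrCA; congr (_ * _).
  have Dau : D (a *: u).
    by rewrite -[_ *: _]addr0; apply: D_lin => //; exists 0 => x; rewrite normr0.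
  apply/eqP; rewrite eq_le; apply/andP; split.
    apply: pos_le; first by rewrite mulr_ge0// pos_ge0.
    by move=> x Zx; apply: ler_wpM2l => //; exact: pos_gex.
  have [->|an0] := eqVneq a 0.
    by rewrite mul0r pos_ge0//; exists 0 => x; rewrite scale0r normr0.
  have a1 : 0 < a by rewrite lt_neqAle eq_sym an0.
  rewrite -ler_pdivlMl//; apply: pos_le; first by rewrite mulr_ge0 ?invr_ge0// pos_ge0.
  by move=> x Zx; rewrite ler_pdivlMl//; exact: (pos_gex (a *: u)).
pose G0 : set (('rV[R]_N -> R) * R) :=
  [set q | exists2 phi, test_fun B phi & q = ((fun x => - opDiv b phi x), l phi)].
have B0 : test_fun B (fun=> 0 : R) := test_fun0 B.
have l0 : l (fun=> 0) = 0.
  have := l_lin 1 _ _ B0 B0.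
  rewrite (_ : (fun x => 1 * 0 + 0) = fun=> 0); last first.
    by apply/funext => x; rewrite mulr0 addr0.
  by rewrite mul1r => /eqP; rewrite -subr_eq0 opprD addNKr oppr_eq0 => /eqP.
have test2 phi : test_fun B phi -> is_Ck 2 setT phi by move=> /test_fun_smooth; exact.
have D_op phi : test_fun B phi -> D (fun x => - opDiv b phi x).
  move=> /test2 H; apply: D_test => x; apply: continuousN.
  exact: is_Ck_cont (is_Ck_opDiv openT b_smooth H) x I.
have dG0 : dominated_graph D p G0.
  split.
  - exists (fun=> 0); first exact: B0.
    by rewrite l0; congr (_, _); apply/funext => x; rewrite opDiv_cst oppr0.
  - move=> a _ _ [phi1 H1 ->] [phi2 H2 ->] /=.
    exists (fun x => a * phi1 x + phi2 x); first exact: test_fun_lin a H1 H2.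
    rewrite (l_lin a _ _ H1 H2); congr (_, _); apply/funext => x.
    rewrite (opDiv_lin a openT b_smooth (test2 _ H1) (test2 _ H2) x I) opprD -mulrN.
    by [].
  - move=> _ [phi H ->] /=; split; first exact: D_op.
    apply: (l_le phi) => //; first exact: pos_ge0 (D_op phi H).
    by move=> x Zx; exact: (pos_gex (fun x => - opDiv b phi x)) (D_op phi H) Zx.
have [T [TG Tlin Tp]] := hahn_banach D p D_lin pD pZ G0 dG0.
have D0 : D 0 by exists 0 => x _; rewrite normr0.
have T0 : T 0 = 0.
  have := Tlin 1 0 0 D0 D0; rewrite scaler0 addr0 mul1r => /eqP.
  by rewrite -subr_eq0 opprD addNKr oppr_eq0 => /eqP.
have TN u : D u -> T (- u) = - T u.
  by move=> Du; have := Tlin (-1) u 0 Du D0; rewrite T0 !addr0 mulN1r scaleN1r.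
have D_phi W phi : test_fun W phi -> D phi.
  move=> /test_fun_smooth H; apply: D_test => x; exact: is_Ck_cont (H 0%N) x I.
exists T; split.
- move=> W WB; split.
    by move=> a phi1 phi2 H1 H2; exact: Tlin (D_phi _ _ H1) (D_phi _ _ H2).
  move=> K cK KW; exists 0%N, c => phi Hphi.
  have Dphi : D phi by apply: (D_phi W); exists K.
  have -> : test_norm 0 K phi = sup [set `|phi x| | x in K].
    rewrite /test_norm big_ord1 (big_pred1 [tuple])// => s.
    by symmetry; apply/eqP/val_inj; case: s => -[].
  set n := sup _.
  have bK : has_ubound [set `|phi x| | x in K].
    have /compact_bounded[M [_ HM]] : compact (phi @` K).
      apply: continuous_compact => //; apply: continuous_subspaceT => x.
      exact: is_Ck_cont (Hphi.1 0%N) x I.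
    exists (M + 1) => _ [x Kx <-]; apply: (HM (M + 1)); first by rewrite ltrDl.
    by exists x.
  have [K0|/set0P[k0 Kk0]] := eqVneq K set0.
    have -> : phi = 0 by apply/funext => x; rewrite Hphi.2// K0.
    rewrite T0 normr0 /n K0 (_ : [set `|phi x| | x in set0] = set0) ?sup0 ?mulr0//.
    by rewrite image_set0.
  have phin x : `|phi x| <= n.
    case: (pselect (K x)) => Kx; first by apply: (ub_le_sup bK); exists x.
    rewrite Hphi.2// normr0; apply: le_trans (normr_ge0 (phi k0)) _.
    by apply: (ub_le_sup bK); exists k0.
  have n0 : 0 <= n by exact: le_trans (normr_ge0 _) (phin k0).
  rewrite ler_norml; apply/andP; split.
    rewrite lerNl -TN//; apply: le_trans (Tp _ _) _.
      by rewrite -[- phi]addr0 -scaleN1r; exact: D_lin.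
    apply: ler_wpM2l => //; apply: pos_le => // x _.
    by apply: le_trans (phin x); rewrite -normrN; exact: ler_norm.
  apply: le_trans (Tp _ Dphi) _; apply: ler_wpM2l => //; apply: pos_le => // x _.
  exact: le_trans (ler_norm _) (phin x).
- move=> phi Hphi; have <- : T (fun x => - opDiv b phi x) = l phi.
    by apply: (TG (_, _)); exists phi.
  rewrite -TN; last exact: D_op.
  by congr T; apply/funext => x; rewrite /= opprK.
- move=> phi Hphi phi0; apply: le_trans (Tp _ (D_phi _ _ Hphi)) _.
  by rewrite -(mulr0 c); apply: ler_wpM2l => //; exact: pos_le.
Qed.

Let B_open : open B.
Proof. exact: cube_open. Qed.

(** The Green functional of the form [phi |-> \int f phi], which the a priori
    estimate bounds since [f >= 0] is supported in [Z], is smooth by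
    hypoellipticity; its density [h] inherits the properties of the functional. *)
Lemma potential Z f : opDiv_hypoelliptic b -> penalizable Z -> Z !=set0 -> test_fun B f ->
  (forall x, 0 <= f x) -> (forall x, ~ Z x -> f x = 0) ->
  exists h, [/\ is_smooth B h, forall x, B x -> 0 <= h x,
    forall x, B x -> ~ Z x -> h x = 0 &
    forall x, B x -> opDiv b h x = - f x].
Proof.
move=> b_hypo tZ Z0 Hf f0 fZ; have [clZ Zcube _] := tZ.
have [Kf [cKf KfB fKf]] := Hf.
have fB : is_smooth B f by move=> k; exact: is_Ck_sub (@subsetT _ B) (fKf.1 k).
have mul_supp g phi : is_Ck 0 B g -> test_fun B phi ->
    exists2 q : R, 0 < q & cont_supp q (fun x => g x * phi x).
  by move=> Hg [K [cK KB Kp]]; exact: test_fun_in_supp B_open cK KB Hg Kp.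
have If0 : 0 <= integral_rV f by exact: integral_rV_ge0.
have C0 : 0 <= C.
  have [z Zz] := Z0; apply: le_trans (psi_ge0 z) _; exact: psi_le _ (Zcube z Zz).
pose l : functional R N := fun phi => integral_rV (fun x => f x * phi x).
have [|||T [Tdist Tl Tpos]] := green_functional Z l (C * integral_rV f) tZ Z0.
- by rewrite mulr_ge0.
- move=> a phi1 phi2 H1 H2; rewrite /l.
  have [q [q0 c1 c2]] := cont_supp_common (mul_supp f phi1 (fB 0%N) H1)
    (mul_supp f phi2 (fB 0%N) H2).
  rewrite -(integral_rV_lin a q0 c1 c2); congr integral_rV; apply/funext => x.
  by rewrite mulrDr mulrCA.
- move=> phi s Hphi s0 Hs; rewrite /l.
  have est := penalizable_estimate Z phi s tZ Hphi s0 Hs.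
  have [q [q0 c1 c2]] := cont_supp_common (mul_supp f phi (fB 0%N) Hphi)
    (mul_supp (fun=> 1) f (is_Ck_cst 1 B_open) Hf).
  have c3 := cont_supp_lin (C * s) c2 cont_supp0.
  have : 0 <= integral_rV (fun x => -1 * (f x * phi x) + (C * s * (1 * f x) + 0)).
    apply: integral_rV_ge0 => x; rewrite mulN1r mul1r addr0 addrC subr_ge0.
    case: (pselect (Z x)) => Zx; last by rewrite fZ// mul0r mulr0.
    by rewrite mulrC; apply: ler_wpM2r => //; exact: est.
  rewrite (integral_rV_lin (-1) q0 c1 c3) (integral_rV_lin (C * s) q0 c2 cont_supp0).
  rewrite integral_rV_cst0 addr0 mulN1r addrC subr_ge0.
  have -> : (fun x => 1 * f x) = f by apply/funext => x; rewrite mul1r.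
  by rewrite mulrAC.
have TB : is_distribution B T := Tdist B (@subset_refl _ B).
have [||h hS hT] := b_hypo B T (fun x => - f x) B_open TB.
- by move=> k; exact: is_CkN B_open (fB k).
- move=> phi Hphi; rewrite (Tl phi Hphi) /l.
  have [q q0 c1] := mul_supp f phi (fB 0%N) Hphi.
  have := integral_rV_lin (-1) q0 c1 cont_supp0; rewrite integral_rV_cst0 addr0 mulN1r => <-.
  by congr integral_rV; apply/funext => x; rewrite mulN1r addr0 mulNr.
have hcont x : B x -> {for x, continuous h} by exact: is_Ck_cont (hS 0%N) x.
exists h; split; first exact: hS.
- apply: (distr_ge0 B_open hcont) => phi Hphi phi0; rewrite -(hT phi Hphi).
  rewrite -oppr_le0 -(distributionN TB Hphi).
  apply: (Tpos _ (test_fun_lin (-1) Hphi (test_fun0 B))) => x _.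
  by rewrite mulN1r addr0 oppr_le0.
- pose W := B `&` ~` Z.
  have oW : open W by apply: openI; [exact: B_open|exact: closed_openC].
  have WB : W `<=` B by move=> x [].
  move=> x Bx nZx; apply: (distr_eq0 oW (fun x Wx => hcont x (WB x Wx)) _ x (conj Bx nZx)).
  move=> phi Hphi; have HphiB := test_fun_sub WB Hphi.
  rewrite -(hT phi HphiB); apply: (distribution_supp TB Tpos phi HphiB) => z Zz.
  by have [K [_ KW Kp]] := Hphi; apply: Kp.2 => /KW[].
- have Lh : is_Ck 0 B (opDiv b h) := is_Ck_opDiv B_open b_smooth (hS 2%N).
  have Lhf : is_Ck 0 B (fun x => opDiv b h x + f x) := is_CkD B_open Lh (fB 0%N).
  have E : forall x, B x -> opDiv b h x + f x = 0.
    apply: (distr_eq0 B_open (is_Ck_cont Lhf)) => phi Hphi.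
    have [q [q0 c1 c2]] := cont_supp_common (mul_supp _ _ Lh Hphi)
      (mul_supp f phi (fB 0%N) Hphi).
    have -> : (fun x => (opDiv b h x + f x) * phi x) =
        (fun x => 1 * (opDiv b h x * phi x) + f x * phi x).
      by apply/funext => x; rewrite mulrDl mul1r.
    rewrite (integral_rV_lin 1 q0 c1 c2) mul1r.
    rewrite -(integral_opDivC B_open b_smooth b_sym (hS 2%N) Hphi).
    by rewrite -(hT _ (test_fun_opDiv b_smooth Hphi)) (Tl phi Hphi) addNr.
  by move=> x Bx; apply/eqP; rewrite -subr_eq0 opprK E.
Qed.

(** Take as source a bump supported in the interior of [Z]. *)
Lemma potential_gt0 Z x : opDiv_hypoelliptic b -> penalizable Z -> interior Z x -> B x ->
  exists h, [/\ is_smooth B h, forall z, B z -> 0 <= h z,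
    forall z, B z -> ~ Z z -> h z = 0,
    forall z, B z -> opDiv b h z <= 0 & 0 < h x].
Proof.
move=> b_hypo tZ Zx Bx.
have /nbhs_ballP[d /= d0 Hd] : nbhs x (Z `&` B).
  by apply: filterI => //; exact: open_nbhs_nbhs (conj B_open Bx).
have d20 : 0 < d / 2 by rewrite divr_gt0.
have [f [fS f0 fp fz _]] := smooth_cutoff x (d / 2) d20.
pose K : set 'rV[R]_N := [set z | `|z - x| <= d / 2].
have KZ z : K z -> Z z /\ B z.
  move=> Kz; apply: Hd; rewrite -ball_normE /= distrC; apply: le_lt_trans Kz _.
  by rewrite ltr_pdivrMr// ltr_pMr// ltr1n.
have Kf z : ~ K z -> f z = 0 by move=> /negP; rewrite -ltNge => /ltW; exact: fz.
have Hf : test_fun B f.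
  by exists K; split; [exact: cube_compact|move=> z /KZ[]|split].
have [h [hS h0 hZ hL]] := potential Z f b_hypo tZ
  (ex_intro _ x (nbhs_singleton Zx)) Hf f0 (fun z nZ => Kf z (fun Kz => nZ (KZ z Kz).1)).
exists h; split=> //; first by move=> z Bz; rewrite hL// oppr_le0.
rewrite lt_neqAle h0// andbT eq_sym; apply/eqP => hx.
(* at a zero, [- h] has a maximum, although [opDiv b (- h) = f > 0] there *)
have hm : max_at B (fun z => -1 * h z + 0) x.
  by split=> // z Bz; rewrite hx mulr0 !addr0 mulN1r oppr_le0 h0.
have H0 : is_Ck 2 B (fun=> 0 : R) := is_Ck_cst 0 B_open.
have := opDiv_le0_at_max B_open b_smooth (b_sym x) (b_psd x)
  (is_CkD B_open (is_CkZ (-1) B_open (hS 2%N)) H0) hm.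
rewrite (opDiv_lin (-1) B_open b_smooth (hS 2%N) H0 x Bx) opDiv_cst addr0 mulN1r.
by rewrite hL// opprK leNgt fp// subrr normr0.
Qed.

(** By the a priori estimate, evaluation at [y] has a Green functional [T] on
    [Z]. Off [y] it is annihilated by [opDiv b], hence smooth; if [Z] had empty
    interior, the density of [T], which vanishes off [Z], would vanish
    identically. But then [T (opDiv b chi)], for a cutoff function [chi] equal
    to 1 near [y], would be 0 instead of [- chi y]. *)
Lemma penalizable_interior Z : opDiv_hypoelliptic b -> 0 < r -> penalizable Z -> Z y ->
  exists x, interior Z x.
Proof.
move=> b_hypo r0 tZ Zy; apply: contrapT => nint; have [clZ Zcube _] := tZ.
have C0 : 0 <= C by exact: le_trans (psi_ge0 y) (psi_le y (Zcube y Zy)).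
have [//||T [Tdist Tl Tpos]] :=
  green_functional Z (fun phi => phi y) C tZ (ex_intro _ y Zy) C0.
  by move=> phi s Hphi s0 Hs; exact: (penalizable_estimate Z phi s tZ Hphi s0 Hs y Zy).
have TB : is_distribution B T := Tdist B (@subset_refl _ B).
pose W : set 'rV[R]_N := B `&` ~` [set y].
have WB : W `<=` B by move=> x [].
have oW : open W.
  apply: openI; [exact: B_open|apply: closed_openC].
  by apply: rV_compact_closed; exact: compact_set1.
have [||g gS gT] := b_hypo W T (fun=> 0) oW (Tdist W WB).
- by move=> k; exact: is_Ck_cst 0 oW.
- move=> phi Hphi; rewrite (Tl phi (test_fun_sub WB Hphi)).
  have -> : phi y = 0 by have [K [_ KW Kp]] := Hphi; apply: Kp.2 => /KW[_]; apply.
  rewrite oppr0 -[LHS](@integral_rV_cst0 R N); congr integral_rV.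
  by apply/funext => x; rewrite mul0r.
have gcont x : W x -> {for x, continuous g} by exact: is_Ck_cont (gS 0%N) x.
have g0 x : W x -> ~ Z x -> g x = 0.
  have oW2 : open (W `&` ~` Z) by apply: openI => //; exact: closed_openC.
  move=> Wx nZx; apply: (distr_eq0 oW2 _ _ x (conj Wx nZx)) => [z [Wz _]|phi Hphi].
    exact: gcont.
  have HphiW : test_fun W phi by apply: test_fun_sub Hphi => z [].
  rewrite -(gT phi HphiW).
  apply: (distribution_supp TB Tpos phi (test_fun_sub WB HphiW)) => z Zz.
  by have [K [_ KW Kp]] := Hphi; apply: Kp.2 => /KW[].
have gW x : W x -> g x = 0.
  move=> Wx; apply: contrapT => /eqP gx; apply: nint; exists x.
  have : nbhs x [set z | g z != 0 /\ W z].
    apply: filterI; last exact: open_nbhs_nbhs (conj oW Wx).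
    exact: (cvgr_neq0 _ (gcont x Wx)).
  apply: filterS => z [gz Wz]; apply: contrapT => nZz.
  by move: gz; rewrite g0// eqxx.
have [chi [chiS chi0 _ chiz chi1]] := smooth_cutoff y (r / 2) (divr_gt0 r0 (ltr0Sn _ 1)).
pose K : set 'rV[R]_N := [set z | `|z - y| <= r / 2].
have KB z : K z -> B z.
  by move=> /le_lt_trans; apply; rewrite ltr_pdivrMr// ltr_pMr// ltr1n.
have Kchi : test_fun_in K chi.
  by split=> // z /negP; rewrite -ltNge => /ltW; exact: chiz.
have cK : compact K by exact: cube_compact.
have chiy : chi y = 1 by apply: chi1; rewrite subrr normr0 !divr_ge0// ltW.
have [Ks Kz] := test_fun_in_opDiv (rV_compact_closed cK) b_smooth Kchi.
pose s := r / 2 / 2; have s0 : 0 < s by rewrite !divr_gt0.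
have near1 z : `|z - y| < s -> opDiv b chi z = 0.
  move=> zs; rewrite -(opDiv_cst b 1 z).
  apply: (opDiv_eq_on b (cube_open y s)); last by rewrite inE.
  by move=> z'; rewrite inE => /ltW; exact: chi1.
have HopW : test_fun W (opDiv b chi).
  exists (K `&` [set z | s <= `|z - y|]); split.
  - apply: compact_closedI => //.
    have -> : [set z : 'rV[R]_N | s <= `|z - y|] = ~` [set z | `|z - y| < s].
      by apply/seteqP; split=> z /=; rewrite leNgt => /negP.
    exact: open_closedC (cube_open y s).
  - move=> z [Kz' zs]; split; first exact: KB.
    by move=> /= zy; move: zs; rewrite /= zy subrr normr0 leNgt s0.
  - split=> // z nKz; case: (pselect (K z)) => Kz'; last exact: Kz.
    by apply: near1; rewrite ltNge; apply/negP => zs; exact: nKz.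
have Hchi : test_fun B chi by exists K.
have := Tl chi Hchi; rewrite chiy (gT _ HopW).
have -> : (fun x => g x * opDiv b chi x) = fun=> 0.
  apply/funext => x; case: (pselect (W x)) => Wx; first by rewrite gW// mul0r.
  by have [K' [_ K'W K'p]] := HopW; rewrite K'p.2 ?mulr0// => /K'W.
by rewrite integral_rV_cst0 => /eqP; rewrite eq_sym oppr_eq0 oner_eq0.
Qed.

End penalizable_sets.

(** * The strong maximum principle *)

(** The zero set [Z1] of [w0] in the cube is penalizable, with [w0] as only
    penalty. If [y] were not interior to it, the frontier [Z2] of [Z1] in a
    smaller cube would be penalizable: the points off [Z1] are penalized by
    [w0], and the interior points of [Z1] by [- h], where [h] is a potential
    that vanishes off [Z1], hence on [Z2]. But [Z2] contains [y] and has empty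
    interior, which contradicts [penalizable_interior]. The smaller cube is needed
    because [h] lives in the open cube only. *)
Lemma zero_set_open {R : realType} {N} (b : 'rV[R]_N -> 'M[R]_N)
    (U : set 'rV[R]_N) (y : 'rV[R]_N) (r kappa : R) (psi w0 : 'rV[R]_N -> R) (C : R) :
  (forall i j, is_smooth setT (fun x => b x i j)) ->
  (forall x, (b x)^T = b x) -> (forall x, pos_semidef (b x)) ->
  opDiv_hypoelliptic b -> open U -> 0 < r ->
  (forall x, `|x - y| <= r -> U x) -> 0 < kappa -> is_smooth setT psi ->
  (forall x, `|x - y| <= r -> 1 <= opDiv b psi x) -> (forall x, 0 <= psi x) ->
  (forall x, `|x - y| <= r -> psi x <= C) -> is_Ck 2 U w0 ->
  (forall x, `|x - y| <= r -> w0 x <= 0) ->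
  (forall x, `|x - y| <= r -> kappa * w0 x <= opDiv b w0 x) ->
  w0 y = 0 -> \forall x \near y, w0 x = 0.
Proof.
move=> Hb bsym bpsd bhypo oU r0 cubeU k0 psiS psi1 psi0 psiC w0S w0N w0L w0y.
apply: contrapT => nint.
have cw0 x : `|x - y| <= r -> {for x, continuous w0}.
  by move=> xr; exact: is_Ck_cont w0S x (cubeU x xr).
pose Z1 : set 'rV[R]_N := [set x | `|x - y| <= r /\ w0 x = 0].
have clZ1 : closed Z1.
  move=> x clx; have xr : `|x - y| <= r.
    have clc : closed [set x : 'rV[R]_N | `|x - y| <= r].
      exact: rV_compact_closed (cube_compact y r).
    by apply: clc => A /clx[z [[zr _] Az]]; exists z.
  split=> //; apply: contrapT => /eqP wx.
  have nA : nbhs x [set z | w0 z != 0] by exact: (cvgr_neq0 _ (cw0 x xr)).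
  by have [z [[_ wz] /=]] := clx _ nA; rewrite wz eqxx.
have tZ1 : penalizable b U y r kappa Z1.
  split=> //; first by move=> x [].
  move=> x xr nZ; exists w0; last first.
    by rewrite lt_neqAle w0N// andbT; apply/eqP => wx; exact: nZ.
  by split; [exact: w0S|exact: w0N|exact: w0L|move=> z []].
have Z1y : Z1 y by split=> //; rewrite subrr normr0 ltW.
pose B : set 'rV[R]_N := [set x | `|x - y| < r].
have oB : open B by exact: cube_open.
have BU : B `<=` U by move=> x /ltW; exact: cubeU.
pose r' := r / 2.
have r'0 : 0 < r' by rewrite divr_gt0.
have r'r : r' < r by rewrite ltr_pdivrMr// ltr_pMr// ltr1n.
have cubeB x : `|x - y| <= r' -> B x by move=> /le_lt_trans; apply.
have cube_r x : `|x - y| <= r' -> `|x - y| <= r by move=> /cubeB/ltW.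
pose Z2 : set 'rV[R]_N := (Z1 `&` ~` interior Z1) `&` [set x | `|x - y| <= r'].
have clZ2 : closed Z2.
  apply: closedI; last exact: rV_compact_closed (cube_compact y r').
  by apply: closedI => //; apply: open_closedC; exact: open_interior.
have tZ2 : penalizable b B y r' kappa Z2.
  split=> //; first by move=> x [].
  move=> x xr' nZ2; case: (pselect (Z1 x)) => Z1x; last first.
    exists w0; last first.
      rewrite lt_neqAle w0N ?cube_r// andbT; apply/eqP => wx; apply: Z1x.
      by split=> //; exact: cube_r.
    split; [exact: is_Ck_sub BU w0S| | |by move=> z [[[]]]].
      by move=> z /cube_r; exact: w0N.
    by move=> z /cube_r; exact: w0L.
  have intx : interior Z1 x by apply: contrapT => nx; apply: nZ2.
  have [h [hS h0 hZ hL hx]] := potential_gt0 b U y r kappa psi C Hb bsym bpsd oU cubeU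
    k0 psiS psi1 psi0 psiC Z1 x bhypo tZ1 intx (cubeB x xr').
  have H0 : is_Ck 2 B (fun=> 0 : R) := is_Ck_cst 0 oB.
  exists (fun z => -1 * h z + 0); last by rewrite addr0 mulN1r oppr_lt0.
  have hN z : B z -> -1 * h z + 0 <= 0.
    by move=> Bz; rewrite addr0 mulN1r oppr_le0 h0.
  split.
  - exact: is_CkD oB (is_CkZ (-1) oB (hS 2%N)) H0.
  - by move=> z /cubeB; exact: hN.
  - move=> z /cubeB Bz; apply: (@le_trans _ _ 0).
      by rewrite pmulr_rle0//; exact: hN.
    rewrite (opDiv_lin (-1) oB Hb (hS 2%N) H0 z Bz) opDiv_cst addr0 mulN1r.
    by rewrite oppr_ge0; exact: hL.
  - move=> z [[_ nz] /cubeB Bz]; suff -> : h z = 0 by rewrite mulr0 addr0.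
    apply: contrapT => /eqP hz; apply: nz.
    have : nbhs z [set z' | h z' != 0 /\ B z'].
      apply: filterI; last exact: open_nbhs_nbhs (conj oB Bz).
      exact: (cvgr_neq0 _ (is_Ck_cont (hS 0%N) z Bz)).
    apply: filterS => z' [hz' Bz']; apply: contrapT => nZz'.
    by move: hz'; rewrite hZ// eqxx.
have Z2y : Z2 y.
  split; last by rewrite /= subrr normr0 ltW.
  by split=> // iy; apply: nint; apply: filterS iy => x [].
have [x Z2x] := penalizable_interior b B y r' kappa psi C Hb bsym bpsd oB cubeB k0 psiS
  (fun x xr => psi1 x (cube_r x xr)) psi0 (fun x xr => psiC x (cube_r x xr))
  Z2 bhypo r'0 tZ2 Z2y.
have [[_ nZx] _] := nbhs_singleton Z2x; apply: nZx.
by apply: filterS Z2x => z [[]].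
Qed.

Theorem theorem1p3 (R : realType) (N : nat)
    (V : 'rV[R]_N -> R) (A : 'rV[R]_N -> 'M[R]_N)
    (V_smooth : is_smooth setT V)
    (V_pos : forall x, 0 < V x)
    (A_smooth : forall i j, is_smooth setT (fun x => A x i j))
    (A_sym : forall x, (A x)^T = A x)
    (A_psd : forall x, pos_semidef (A x))
    (A_neq0 : forall x, A x != 0)
    (L_hypo : forall W : set 'rV[R]_N, open W -> hypoelliptic (distr_opL V A) W)
    (Omega : set 'rV[R]_N)
    (Omega_open : open Omega)
    (Omega_connected : connected Omega) :
  (forall u : 'rV[R]_N -> R, is_Ck 2 Omega u ->
     (forall x, Omega x -> 0 <= opL V A u x) ->
     (exists x0, max_at Omega u x0) ->
     constant_on Omega u) /\
  (forall c : 'rV[R]_N -> R, is_smooth setT c -> (forall x, 0 <= c x) ->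
     forall u : 'rV[R]_N -> R, is_Ck 2 Omega u ->
     (forall x, Omega x -> 0 <= opLc V A c u x) ->
     (exists x0, max_at Omega u x0 /\ 0 <= u x0) ->
     constant_on Omega u).
Proof.
pose b (x : 'rV[R]_N) : 'M[R]_N := V x *: A x.
have Hb i j : is_smooth setT (fun x => b x i j).
  move=> k; apply: (is_Ck_eq_on openT _ (is_CkM openT (V_smooth k) (A_smooth i j k))).
  by move=> x _; rewrite mxE.
have bsym x : (b x)^T = b x by rewrite linearZ /= A_sym.
have bpsd x : pos_semidef (b x).
  move=> v; rewrite -scalemxAr -scalemxAl mxE mulr_ge0//; first exact: ltW.
  exact: A_psd.
have b0 x : b x != 0 by rewrite scaler_eq0 negb_or gt_eqF//= A_neq0.
have bhypo : opDiv_hypoelliptic b.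
  exact: opL_hypoelliptic_opDiv V A V_smooth V_pos A_smooth A_sym L_hypo.
(* this is part (1) for [c = 0]; in part (2), [0 <= u x0] gives
   [c (u - u x0) <= c u <= L u] *)
suff main (c u : 'rV[R]_N -> R) (x0 : 'rV[R]_N) : is_smooth setT c ->
    (forall x, 0 <= c x) -> is_Ck 2 Omega u -> max_at Omega u x0 ->
    (forall x, Omega x -> c x * (u x - u x0) <= opL V A u x) -> constant_on Omega u.
  split=> [u Hu Lu [x0 Hx0]|c Hc c0 u Hu Lu [x0 [Hx0 ux0]]].
    apply: (main (fun=> 0) u x0) => // [k|x Ox]; first exact: is_Ck_cst 0 openT.
    by rewrite mul0r; exact: Lu.
  apply: (main c u x0) => // x Ox.
  have := Lu x Ox; rewrite /opLc subr_ge0; apply: le_trans.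
  by rewrite mulrBr gerBl mulr_ge0.
move=> cS c0 Hu [Ox0 umax] Lu.
pose w x := 1 * u x + (- u x0).
have wE x : w x = u x - u x0 by rewrite /w mul1r.
have HM : is_Ck 2 Omega (fun=> - u x0) := is_Ck_cst _ Omega_open.
have wS : is_Ck 2 Omega w := is_CkD Omega_open (is_CkZ 1 Omega_open Hu) HM.
have wN x : Omega x -> w x <= 0 by move=> Ox; rewrite wE subr_le0 umax.
have wL x : Omega x -> V x * c x * w x <= opDiv b w x.
  move=> Ox; rewrite (opDiv_lin 1 Omega_open Hb Hu HM x Ox) opDiv_cst addr0 mul1r.
  have := Lu x Ox; rewrite (opL_opDiv V A) -/b -wE -mulrA.
  by rewrite ler_pdivlMl.
pose F : set 'rV[R]_N := [set x | Omega x /\ w x = 0].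
suff FE : F = Omega.
  exists (u x0) => x Ox; have : F x by rewrite FE.
  by move=> [_ /eqP]; rewrite wE subr_eq0 => /eqP.
apply: Omega_connected.
- by exists x0; split=> //; rewrite wE subrr.
- exists (interior F); first exact: open_interior.
  apply/seteqP; split=> [z Fz|z [_ /nbhs_singleton]//].
  have [Oz wz] := Fz; split=> //.
  have [r [psi [C [r0 rO psiS [psi1 psi0 psiC]]]]] :=
    barrier b z Omega Hb (bsym z) (bpsd z) (b0 z) (open_nbhs_nbhs (conj Omega_open Oz)).
  (* an upper bound of [V c] on the cube *)
  have [kappa k0 Hk] : exists2 kappa : R, 0 < kappa &
      forall x, `|x - z| <= r -> V x * c x <= kappa.
    have VcS : is_Ck 0 setT (fun x => V x * c x) := is_CkM openT (V_smooth 0%N) (cS 0%N).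
    have [m] : exists2 m, m \in [set x | `|x - z| <= r] &
        forall t, t \in [set x | `|x - z| <= r] -> V t * c t <= V m * c m.
      apply: EVT_max_rV; [|exact: cube_compact|].
        by exists z; rewrite /= subrr normr0 ltW.
      by apply: continuous_subspaceT => x; exact: is_Ck_cont VcS x I.
    move=> _ Hm; exists (V m * c m + 1).
      by rewrite ltr_wpDl// mulr_ge0// ltW.
    move=> x xr; apply: (@le_trans _ _ (V m * c m)); last by rewrite lerDl.
    by apply: Hm; rewrite inE.
  have := zero_set_open b Omega z r kappa psi w C Hb bsym bpsd bhypo Omega_open r0 rO
    k0 psiS psi1 psi0 psiC wS (fun x xr => wN x (rO x xr)) _ wz.
  move=> H; have {}H : \forall x \near z, w x = 0.
    apply: H => x xr; apply: le_trans (wL x (rO x xr)).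
    by apply: ler_wnM2r; [exact: wN (rO x xr)|exact: Hk].
  near=> x; split; last by near: x.
  by near: x; exact: open_nbhs_nbhs (conj Omega_open Oz).
- exists (closure F); first exact: closed_closure.
  apply/seteqP; split=> [z Fz|z [Oz clz]]; first by split; [case: Fz|exact: subset_closure].
  split=> //; apply: contrapT => /eqP wz.
  have nz : nbhs z [set x | w x != 0] by exact: (cvgr_neq0 _ (is_Ck_cont wS z Oz)).
  by have [x [[_ wx] /=]] := clz _ nz; rewrite wx eqxx.
Unshelve. all: by end_near. Qed.
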